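(* Let $V$ be a vector space over a field $\mathbb{F}$ with a linearly ordered basis $\mathbb{B}$, and let $p,t\in\mathbb{F}$ be nonzero. Let $\rho=(\phi_t\otimes\lambda_R)(\hat\tau\otimes\mathrm{id})(\mathrm{id}\otimes\Delta)\colon\Lambda_p(V)^{\otimes2}\to\Lambda_p(V)^{\otimes2}$. For finite $E,F\subseteq\mathbb{B}$ define the matrix coefficients $r_{E,G;F,H}$ of $\rho$ by $$\rho f_{E,F}=(-1)^{|E||F|}\sum_{G,H}r_{E,G;F,H}\,f_{F',E'},\qquad E'=(E\setminus G)\sqcup H,\quad F'=(F\setminus H)\sqcup G,$$ where the summation runs over $G\subseteq E\setminus F$ and $H\subseteq F\setminus E$ such that $|H|\ge|G|$ and the map $G\to\mathbb{Z}_{\ge0}$, $g\mapsto\theta_{\{g\},H}$, is injective with image contained in $\mathbb{Z}_{>0}$. Then these coefficients are given by $$r_{E,G;F,H}=t^{|F'|}\,(tp^{|E|};p)_{|H|-|G|}\,\beta_{E,G;F,H},$$ where $$\beta_{E,G;F,H}=(-1)^{\theta_{F,E}+\theta_{F',E'}}\,p^{\theta_{G\sqcup C,E}+\theta_{\dot F,E'}}\prod_{g\in G}\big(p^{\theta_{\{g\},H}-\theta_{\{g\},G}}-1\big),\qquad C=E\cap F,\quad \dot F=(F\setminus E)\setminus H.$$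
   Context: For $a,b\in\mathbb{B}$: $\theta_{a,b}=1$ if $a>b$ and $0$ otherwise; for finite subsets $A,B\subseteq\mathbb{B}$, $\theta_{A,B}=\sum_{a\in A}\sum_{b\in B}\theta_{a,b}$. $(x;p)_n=\prod_{i=0}^{n-1}(1-xp^i)$. Braided Hopf algebra $\Lambda_p(V)$: let $\tau$ on $V\otimes V$ be given by $\tau(a\otimes a)=-a\otimes a$; $\tau(a\otimes b)=-(1-p)a\otimes b-b\otimes a$ if $a>b$; $\tau(a\otimes b)=-p\,b\otimes a$ if $a<b$ ($a,b\in\mathbb{B}$). As an algebra $\Lambda_p(V)$ is the exterior algebra $\bigwedge V$, with product $\nabla$ and unit $1$. Its braiding $\hat\tau$ is the unique linear map on $\Lambda_p(V)^{\otimes2}$ with $\hat\tau|_{V\otimes V}=\tau$, $\hat\tau(1\otimes x)=x\otimes1$, $\hat\tau(x\otimes1)=1\otimes x$, $\hat\tau(\nabla\otimes\nabla)=(\nabla\otimes\nabla)(\mathrm{id}\otimes\hat\tau\otimes\mathrm{id})(\hat\tau\otimes\hat\tau)(\mathrm{id}\otimes\hat\tau\otimes\mathrm{id})$. Its coproduct $\Delta$ is the unique linear map with $\Delta1=1\otimes1$, $\Delta v=v\otimes1+1\otimes v$ ($v\in V$), $\Delta\nabla=(\nabla\otimes\nabla)(\mathrm{id}\otimes\hat\tau\otimes\mathrm{id})(\Delta\otimes\Delta)$. The counit kills positive degrees and sends $1$ to $1$, and the antipode $S$ is the convolution inverse of $\mathrm{id}$. For a finite $E=\{e_1<\dots<e_n\}\subseteq\mathbb{B}$,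 $f_E=e_1\cdots e_n$ ($f_\emptyset=1$); these form a basis of $\Lambda_p(V)$; $f_{E,F}=f_E\otimes f_F$. The automorphism $\phi_t$ is given by $\phi_tf_E=t^{|E|}f_E$. The right action is $\lambda_R=\nabla^{(2)}((S\phi_t)\otimes\mathrm{id}\otimes\mathrm{id})(\hat\tau\otimes\mathrm{id})(\mathrm{id}\otimes\Delta)\colon\Lambda_p(V)^{\otimes2}\to\Lambda_p(V)$ with $\nabla^{(2)}=\nabla(\nabla\otimes\mathrm{id})$.
   Formalization: The sum is false for the stated (G,H): for E={3,4}, F={1,2} it omits G=E, H=F, whose coefficient is nonzero for generic p. The expansion is proved with θ_{g,G}<θ_{g,H} for all g∈G instead of injectivity and positivity; the formula for r is proved on both sets. *)

(* Defs.v *)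
From HB Require Import structures.
From mathcomp Require Import all_boot all_order all_algebra.
From mathcomp Require Import finmap monalg.

Set Implicit Arguments.
Unset Strict Implicit.
Unset Printing Implicit Defensive.

Import Order.TTheory GRing.Theory.

Local Open Scope fset_scope.
Local Open Scope ring_scope.

(* A K-space with basis I is {malg K[I]}, the finitely supported functions    *)
(* I -> K, with basis vectors << i >>; lin phi is the linear map sending      *)
(* << i >> to phi i.  The tensor product of the spaces with bases I and J is  *)
(* {malg K[I * J]}, with tens x y the pure tensor of x and y.                 *)

Section FreeModules.
Variable K : fieldType.

Definition lin (I : choiceType) (M : lmodType K) (phi : I -> M)
    (x : {malg K[I]}) : M :=
  \sum_(i <- msupp x) x@_i *: phi i.

Lemma linEw (I : choiceType) (M : lmodType K) (phi : I -> M) (x : {malg K[I]})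
    (A : {fset I}) :
  msupp x `<=` A -> lin phi x = \sum_(i <- A) x@_i *: phi i.
Proof.
move=> sxA; rewrite /lin; apply: big_fset_incl => // i _ /mcoeff_outdom ->.
by rewrite scale0r.
Qed.

Fact lin_is_linear (I : choiceType) (M : lmodType K) (phi : I -> M) :
  linear (lin phi).
Proof.
move=> c x y; pose A := msupp x `|` msupp y `|` msupp (c *: x + y).
rewrite (@linEw _ _ phi (c *: x + y) A) ?fsubsetUr //.
rewrite (@linEw _ _ phi x A); last by rewrite /A -fsetUA fsubsetUl.
rewrite (@linEw _ _ phi y A); last first.
  by rewrite /A (fsetUC (msupp x)) -fsetUA fsubsetUl.
rewrite scaler_sumr -big_split; apply: eq_bigr => i _ /=.
by rewrite mcoeffD mcoeffZ scalerDl scalerA.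
Qed.

HB.instance Definition _ (I : choiceType) (M : lmodType K) (phi : I -> M) :=
  GRing.isLinear.Build K {malg K[I]} M _ (lin phi) (lin_is_linear phi).

Lemma linU (I : choiceType) (M : lmodType K) (phi : I -> M) i :
  lin phi << i >> = phi i.
Proof.
rewrite (@linEw _ _ _ _ [fset i]) ?msuppU_le // big_seq_fset1.
by rewrite mcoeffUU scale1r.
Qed.

Lemma malgU_scale (I : choiceType) (c : K) (i : I) :
  << c *g i >> = c *: << i >> :> {malg K[I]}.
Proof. by apply/malgP => j; rewrite mcoeffZ !mcoeffU mulr_natr. Qed.

Lemma linear_ext (I : choiceType) (M : lmodType K)
    (f g : {linear {malg K[I]} -> M}) :
  (forall i, f << i >> = g << i >>) -> f =1 g.
Proof.
move=> fg x; rewrite [x]monalgE !linear_sum; apply: eq_bigr => i _.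
by rewrite malgU_scale !linearZ_LR fg.
Qed.

Lemma mulr_lin (I : choiceType) (A : algType K) (a : A) (phi : I -> A) x :
  a * lin phi x = lin (fun i => a * phi i) x.
Proof. by rewrite /lin mulr_sumr; apply: eq_bigr => i _; rewrite scalerAr. Qed.

Lemma mull_lin (I : choiceType) (A : algType K) (a : A) (phi : I -> A) x :
  lin phi x * a = lin (fun i => phi i * a) x.
Proof. by rewrite /lin mulr_suml; apply: eq_bigr => i _; rewrite scalerAl. Qed.

Definition tens (I J : choiceType) (x : {malg K[I]}) (y : {malg K[J]}) :
    {malg K[(I * J)%type]} :=
  lin (fun i => lin (fun j => << (i, j) >>) y) x.

Lemma tensUU (I J : choiceType) (i : I) (j : J) :
  tens << i >> << j >> = << (i, j) >> :> {malg K[(I * J)%type]}.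
Proof. by rewrite /tens !linU. Qed.

Fact tens_is_linear (I J : choiceType) (x : {malg K[I]}) :
  linear (@tens I J x).
Proof.
move=> c y z; rewrite /tens /lin scaler_sumr -big_split; apply: eq_bigr => i _ /=.
by rewrite -!/(lin _ _) linearP scalerDr !scalerA [_ * c]mulrC.
Qed.

HB.instance Definition _ (I J : choiceType) (x : {malg K[I]}) :=
  GRing.isLinear.Build K {malg K[J]} {malg K[(I * J)%type]} _ (tens x)
    (tens_is_linear x).

Definition tmap (I J I' J' : choiceType) (f : {malg K[I]} -> {malg K[I']})
    (g : {malg K[J]} -> {malg K[J']}) :
    {malg K[(I * J)%type]} -> {malg K[(I' * J')%type]} :=
  lin (fun ij => tens (f << ij.1 >>) (g << ij.2 >>)).

Definition assocl (I J L : choiceType) :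
    {malg K[(I * (J * L))%type]} -> {malg K[(I * J * L)%type]} :=
  lin (fun k => << (k.1, k.2.1, k.2.2) >>).

Definition assocr (I J L : choiceType) :
    {malg K[(I * J * L)%type]} -> {malg K[(I * (J * L))%type]} :=
  lin (fun k => << (k.1.1, (k.1.2, k.2)) >>).

(* id (x) g (x) id *)
Definition tmid (I : choiceType)
    (g : {malg K[(I * I)%type]} -> {malg K[(I * I)%type]}) :
    {malg K[((I * I) * (I * I))%type]} -> {malg K[((I * I) * (I * I))%type]} :=
  lin (fun k => lin (fun bc => << ((k.1.1, bc.1), (bc.2, k.2.2)) >>)
                    (g << (k.1.2, k.2.1) >>)).

End FreeModules.

Section Theta.
Context {d : Order.disp_t} {B : orderType d}.
Implicit Types E F G H : {fset B}.

Definition theta E F : nat := (\sum_(a <- E) \sum_(b <- F) (b < a)%O)%N.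

Lemma sum_disjoint_fsetU E F (f : B -> nat) : [disjoint E & F] ->
  (\sum_(x <- E `|` F) f x = \sum_(x <- E) f x + \sum_(x <- F) f x)%N.
Proof.
move=> /fdisjointP dEF; rewrite -big_cat; apply: perm_big; apply: uniq_perm.
- exact: fset_uniq.
- rewrite cat_uniq !fset_uniq andbT /=; apply/hasPn => x xF.
  by apply/negP => /dEF; rewrite xF.
- by move=> x; rewrite mem_cat inE.
Qed.

Lemma theta0l F : theta fset0 F = 0%N.
Proof. by rewrite /theta big_seq_fset0. Qed.

Lemma theta0r E : theta E fset0 = 0%N.
Proof. by rewrite /theta big1 // => a _; rewrite big_seq_fset0. Qed.

Lemma thetaUl E F G : [disjoint E & F] ->
  theta (E `|` F) G = (theta E G + theta F G)%N.
Proof. exact: sum_disjoint_fsetU. Qed.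

Lemma thetaUr E F G : [disjoint F & G] ->
  theta E (F `|` G) = (theta E F + theta E G)%N.
Proof.
move=> dFG; rewrite /theta -big_split; apply: eq_bigr => a _.
exact: sum_disjoint_fsetU.
Qed.

End Theta.

Section Exterior.
Context {d : Order.disp_t} {B : orderType d} (K : fieldType).
Implicit Types E F G H : {fset B}.

Definition fE E : {malg K[{fset B}]} := << E >>.

Lemma lin_fE (M : lmodType K) (phi : {fset B} -> M) E : lin phi (fE E) = phi E.
Proof. exact: linU. Qed.

Definition inV : {malg K[B]} -> {malg K[{fset B}]} :=
  lin (fun b => fE [fset b]).

HB.instance Definition _ := GRing.Linear.on inV.

(* The space V with basis B is {malg K[B]}, and inV embeds it in its exterior *)
(* algebra, presented by the basis of ordered monomials fE E (fE_sorted):     *)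
(* reordering e_1 ... e_m f_1 ... f_n costs one sign per inversion.  See      *)
(* wedgeA, wedge_inV_sq and exterior_universal for the universal property.    *)
Definition nabla : {malg K[({fset B} * {fset B})%type]} -> {malg K[{fset B}]} :=
  lin (fun EF : ({fset B} * {fset B})%type =>
    if [disjoint EF.1 & EF.2]%fset
    then (-1) ^+ theta EF.1 EF.2 *: fE (EF.1 `|` EF.2) else 0).

HB.instance Definition _ := GRing.Linear.on nabla.

Definition wedge (x y : {malg K[{fset B}]}) := nabla (tens x y).

Lemma wedgeUU E F : wedge (fE E) (fE F) =
  if [disjoint E & F]%fset then (-1) ^+ theta E F *: fE (E `|` F) else 0.
Proof. by rewrite /wedge tensUU /nabla linU. Qed.

Fact wedge_is_linear x : linear (wedge x).
Proof. by move=> c y z; rewrite /wedge !linearP. Qed.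

HB.instance Definition _ x :=
  GRing.isLinear.Build K _ _ _ (wedge x) (wedge_is_linear x).

Definition rwedge (y x : {malg K[{fset B}]}) := wedge x y.

Fact rwedge_is_linear y : linear (rwedge y).
Proof. by move=> c x z; rewrite /rwedge /wedge /tens !linearP. Qed.

HB.instance Definition _ y :=
  GRing.isLinear.Build K _ _ _ (rwedge y) (rwedge_is_linear y).

Lemma wedge0r x : wedge x 0 = 0. Proof. exact: (linear0 (wedge x)). Qed.
Lemma wedge0l y : wedge 0 y = 0. Proof. exact: (linear0 (rwedge y)). Qed.
Lemma wedgeZr c x y : wedge x (c *: y) = c *: wedge x y.
Proof. exact: (linearZ_LR (wedge x)). Qed.
Lemma wedgeZl c x y : wedge (c *: x) y = c *: wedge x y.
Proof. exact: (linearZ_LR (rwedge y)). Qed.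
Lemma wedgeDr x y z : wedge x (y + z) = wedge x y + wedge x z.
Proof. exact: (linearD (wedge x)). Qed.
Lemma wedgeDl x y z : wedge (x + y) z = wedge x z + wedge y z.
Proof. exact: (linearD (rwedge z)). Qed.

(* Without this, failing unifications unfold the finitely supported sums.     *)
#[local] Opaque fE wedge inV lin GRing.scale.

Lemma wedge1l : left_id (fE fset0) wedge.
Proof.
move=> x; apply: (linear_ext (f := wedge (fE fset0)) (g := idfun)) => F /=.
by rewrite wedgeUU fdisjoint0X theta0l expr0 scale1r fset0U.
Qed.

Lemma wedge1r : right_id (fE fset0) wedge.
Proof.
move=> x; apply: (linear_ext (f := rwedge (fE fset0)) (g := idfun)) => F /=.
by rewrite /rwedge wedgeUU fdisjointX0 theta0r expr0 scale1r fsetU0.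
Qed.

Lemma wedgeA : associative wedge.
Proof.
have basisA E F G :
    wedge (fE E) (wedge (fE F) (fE G)) = wedge (wedge (fE E) (fE F)) (fE G).
  rewrite !wedgeUU.
  have [dEF|nEF] := boolP [disjoint E & F]%fset;
    have [dFG|nFG] := boolP [disjoint F & G]%fset.
  - rewrite wedgeZr wedgeZl !wedgeUU.
    rewrite fdisjointXU fdisjointUX dEF dFG andbT /=.
    case dEG: [disjoint E & G]%fset; cbv iota; last by rewrite !scaler0.
    rewrite !scalerA -!exprD (thetaUl _ dEF) (thetaUr _ dFG) fsetUA.
    by congr ((-1) ^+ _ *: _); rewrite addnC addnA.
  - rewrite wedge0r wedgeZl wedgeUU.
    by rewrite fdisjointUX (negPf nFG) andbF scaler0.
  - by rewrite wedge0l wedgeZr wedgeUU fdisjointXU (negPf nEF) scaler0.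
  - by rewrite wedge0r wedge0l.
have basisA2 E F z :
    wedge (fE E) (wedge (fE F) z) = wedge (wedge (fE E) (fE F)) z.
  have := linear_ext (f := wedge (fE E) \o wedge (fE F))
                     (g := wedge (wedge (fE E) (fE F))).
  by move=> /(_ (basisA E F))/(_ z).
have basisA1 E y z : wedge (fE E) (wedge y z) = wedge (wedge (fE E) y) z.
  have := linear_ext (f := wedge (fE E) \o rwedge z)
                     (g := rwedge z \o wedge (fE E)).
  by move=> /(_ (fun F => basisA2 E F z))/(_ y).
move=> x y z.
have := linear_ext (f := rwedge (wedge y z)) (g := rwedge z \o rwedge y).
by move=> /(_ (fun E => basisA1 E y z))/(_ x).
Qed.

Lemma inVU b : inV << b >> = fE [fset b].
Proof. exact: linU. Qed.

Lemma wedge_inVC x y : wedge (inV x) (inV y) = - wedge (inV y) (inV x).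
Proof.
have basisC b c : wedge (inV << b >>) (inV << c >>) =
    - wedge (inV << c >>) (inV << b >>).
  rewrite !inVU !wedgeUU !fdisjointX1 !inE [c == b]eq_sym.
  have [|b_neq_c] /= := eqVneq b c; first by rewrite oppr0.
  rewrite /theta !big_seq_fset1 fsetUC.
  by case: ltgtP b_neq_c => // _ _; rewrite expr0 expr1 !scaleN1r scale1r ?opprK.
have basisC1 b z : wedge (inV << b >>) (inV z) =
    - wedge (inV z) (inV << b >>).
  have := linear_ext (f := wedge (inV << b >>) \o inV)
                     (g := -%R \o rwedge (inV << b >>) \o inV).
  by move=> /(_ (fun c => basisC b c))/(_ z).
have := linear_ext (f := rwedge (inV y) \o inV)
                   (g := -%R \o wedge (inV y) \o inV).
by move=> /(_ (fun b => basisC1 b y))/(_ x).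
Qed.

Lemma wedge_inV_sq x : wedge (inV x) (inV x) = 0.
Proof.
rewrite [x]monalgE.
elim/big_ind: _ => [|y z yy zz|b _]; first by rewrite linear0 wedge0l.
- rewrite (linearD inV) /=; move: (inV y) (inV z) yy zz (wedge_inVC y z).
  move=> u v uu vv uv.
  by rewrite wedgeDl (wedgeDr u) (wedgeDr v) uu vv uv add0r addr0 addNr.
- rewrite malgU_scale (linearZ_LR inV) /= inVU wedgeZl wedgeZr wedgeUU.
  by rewrite fdisjointX1 !inE eqxx !scaler0.
Qed.

Lemma wedgeU_min b E : (forall c, c \in E -> (b < c)%O) ->
  wedge (fE [fset b]) (fE E) = fE (b |` E).
Proof.
move=> ltbE; rewrite wedgeUU fdisjoint1X.
have -> : b \notin E by apply/negP => /ltbE; rewrite ltxx.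
rewrite /theta big_seq_fset1 big_seq big1 ?expr0 ?scale1r // => c /ltbE.
by case: ltgtP.
Qed.

Lemma fset_min_ind (P : {fset B} -> Prop) :
  P fset0 ->
  (forall b E, (forall c, c \in E -> (b < c)%O) -> P E -> P (b |` E)) ->
  forall E, P E.
Proof.
move=> P0 PU E; have [s] : {s | sorted <%O s & E = [fset x in s]}.
  exists (sort <=%O E); first by rewrite sort_lt_sorted fset_uniq.
  by apply/fsetP => x; rewrite !inE mem_sort.
elim: s E => [|b s IHs] E /=; first by move=> _ ->; rewrite fset_nil.
move=> bs ->; rewrite fset_cons; apply: PU => [c|].
  by rewrite inE => cs; move: bs; rewrite (path_sortedE lt_trans) => /andP[/allP ->].
exact/IHs/erefl/(path_sorted bs).
Qed.

Lemma sort_fset0 : sort <=%O (fset0 : {fset B}) = [::].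
Proof. by apply: size0nil; rewrite size_sort cardfs0. Qed.

Lemma sort_min b E : (forall c, c \in E -> (b < c)%O) ->
  sort <=%O (b |` E) = b :: sort <=%O E :> seq B.
Proof.
move=> ltbE; have bE : b \notin E by apply/negP => /ltbE; rewrite ltxx.
apply: lt_sorted_eq; first by rewrite sort_lt_sorted fset_uniq.
  rewrite /= (path_sortedE lt_trans) sort_lt_sorted fset_uniq andbT.
  by apply/allP => c; rewrite mem_sort => /ltbE.
by move=> c; rewrite mem_sort !inE mem_sort.
Qed.

Lemma fE_sorted E :
  fE E = foldr wedge (fE fset0) [seq fE [fset b] | b <- sort <=%O E].
Proof.
elim/fset_min_ind: E => [|b E ltbE IHE].
  by rewrite sort_fset0.
by rewrite sort_min //= -IHE wedgeU_min.
Qed.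

Lemma exterior_universal_uniq (A : algType K)
    (h h' : {linear {malg K[{fset B}]} -> A}) :
  h (fE fset0) = 1 -> {morph h : x y / wedge x y >-> x * y} ->
  h' (fE fset0) = 1 -> {morph h' : x y / wedge x y >-> x * y} ->
  h \o inV =1 h' \o inV -> h =1 h'.
Proof.
move=> h1 hM h'1 h'M hh'; apply: linear_ext => E.
change (h (fE E) = h' (fE E)).
elim/fset_min_ind: E => [|b E ltbE IHE]; first by rewrite h1 h'1.
rewrite -(wedgeU_min ltbE) hM h'M IHE -inVU; congr (_ * _); exact: hh'.
Qed.

Lemma exterior_universal (A : algType K) (g : {linear {malg K[B]} -> A}) :
  (forall v, g v * g v = 0) ->
  exists h : {linear {malg K[{fset B}]} -> A},
    [/\ h (fE fset0) = 1, {morph h : x y / wedge x y >-> x * y} &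
        h \o inV =1 g].
Proof.
move=> gg; have gC u v : g u * g v = - (g v * g u).
  apply/eqP; rewrite -subr_eq0 opprK; have := gg (u + v).
  by rewrite linearD mulrDl !mulrDr !gg add0r addr0 => ->.
pose hE E : A := \prod_(b <- sort <=%O E) g << b >>.
have hE0 : hE fset0 = 1.
  by rewrite /hE sort_fset0 big_nil.
have hEU b E : (forall c, c \in E -> (b < c)%O) -> hE (b |` E) = g << b >> * hE E.
  by move=> ltbE; rewrite /hE sort_min // big_cons.
have h1E b E : lin hE (wedge (fE [fset b]) (fE E)) = g << b >> * hE E.
  elim/fset_min_ind: E => [|c E ltcE IHE].
    by rewrite wedge1r lin_fE -[X in hE X]fsetU0 hEU // => c; rewrite inE.
  have cE : c \notin E by apply/negP => /ltcE; rewrite ltxx.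
  move: IHE; rewrite !wedgeUU !fdisjoint1X !inE negb_or hEU //.
  have [<-{c ltcE cE}|b_neq_c] /= := eqVneq b c.
    by rewrite linear0 mulrA gg mul0r.
  have -> : theta [fset b] (c |` E) = ((c < b)%O + theta [fset b] E)%N.
    by rewrite thetaUr ?fdisjoint1X // {1}/theta !big_seq_fset1.
  case: ltgtP b_neq_c => // [c_lt_b|b_lt_c] _; last first.
    have ltbE e : e \in c |` E -> (b < e)%O.
      by rewrite !inE => /predU1P[->//|/ltcE]; exact: (lt_trans b_lt_c).
    have bE : b \notin E by apply/negP => /ltcE/lt_gtF; rewrite b_lt_c.
    rewrite bE => _; rewrite (linearZ_LR (lin hE)) /= lin_fE (hEU b) // (hEU c) //.
    rewrite /theta big_seq_fset1 big_seq big1 ?scale1r // => e eE.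
    by have := ltbE e; rewrite !inE eE orbT => /(_ isT); case: ltgtP.
  rewrite mulrA gC mulNr -mulrA => <-.
  have -> : [fset b] `|` (c |` E) = c |` (b |` E) by rewrite fsetUCA.
  case: (b \notin E); last by rewrite (linear0 (lin hE)) mulr0 oppr0.
  rewrite !(linearZ_LR (lin hE)) /= !lin_fE.
  rewrite add1n exprS mulN1r scaleNr hEU ?scalerAr // => e.
  by rewrite !inE => /predU1P[->//|/ltcE].
have h1 b x : lin hE (wedge (fE [fset b]) x) = g << b >> * lin hE x.
  rewrite mulr_lin.
  have := linear_ext (f := lin hE \o wedge (fE [fset b]))
                     (g := lin (fun E => g << b >> * hE E)).
  by move=> /(_ _ x); apply=> E /=; rewrite -/(fE E) h1E linU.
have hM1 E y : lin hE (wedge (fE E) y) = hE E * lin hE y.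
  elim/fset_min_ind: E => [|b E ltbE IHE]; first by rewrite wedge1l hE0 mul1r.
  by rewrite -(wedgeU_min ltbE) -wedgeA h1 IHE mulrA hEU.
exists (lin hE); split=> [|x y|v] /=; first by rewrite lin_fE.
- rewrite mull_lin.
  have := linear_ext (f := lin hE \o rwedge y)
                     (g := lin (fun E => hE E * lin hE y)).
  by move=> /(_ _ x); apply=> E /=; rewrite [RHS]linU; exact: hM1.
- have := linear_ext (f := lin hE \o inV) (g := g).
  move=> /(_ _ v); apply=> b /=.
  by rewrite inVU lin_fE -[X in hE X]fsetU0 hEU ?hE0 ?mulr1 // => c; rewrite inE.
Qed.

End Exterior.

Arguments inV {d B K} x.
Arguments nabla {d B K} x.
Arguments wedge {d B K} x y.

Section BraidedHopf.
Context {d : Order.disp_t} {B : orderType d} {K : fieldType}.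
Implicit Types E F G H : {fset B}.
Implicit Types p t : K.

Local Notation V2 := {malg K[(B * B)%type]}.
Local Notation L := {malg K[{fset B}]}.
Local Notation L2 := {malg K[({fset B} * {fset B})%type]}.
Local Notation one := (fE K fset0).

Definition tau p : V2 -> V2 :=
  lin (fun ab => let: (a, b) := ab in
    if a == b then - << (a, a) >>
    else if (b < a)%O then - (1 - p) *: << (a, b) >> - << (b, a) >>
    else - p *: << (b, a) >>).

Definition is_braiding p (tauhat : {linear L2 -> L2}) : Prop :=
  [/\ forall v, tauhat (tmap inV inV v) = tmap inV inV (tau p v),
      forall x, tauhat (tens one x) = tens x one,
      forall x, tauhat (tens x one) = tens one x
    & forall x, tauhat (tmap nabla nabla x) =
        tmap nabla nabla (tmid tauhat (tmap tauhat tauhat (tmid tauhat x)))].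

Definition is_coproduct (tauhat : {linear L2 -> L2})
    (Delta : {linear L -> L2}) : Prop :=
  [/\ Delta one = tens one one,
      forall v, Delta (inV v) = tens (inV v) one + tens one (inV v)
    & forall x, Delta (nabla x) =
        tmap nabla nabla (tmid tauhat (tmap Delta Delta x))].

Definition counit (x : L) : K := x@_fset0.

Definition is_antipode (Delta : {linear L -> L2}) (S : {linear L -> L}) : Prop :=
  (forall x, nabla (tmap S id (Delta x)) = counit x *: one) /\
  (forall x, nabla (tmap id S (Delta x)) = counit x *: one).

Definition phi t : L -> L := lin (fun E => t ^+ #|` E| *: fE K E).

Definition nabla2 : {malg K[({fset B} * {fset B} * {fset B})%type]} -> L :=
  nabla \o tmap nabla id.

Definition lambdaR t (tauhat : {linear L2 -> L2}) (Delta : {linear L -> L2})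
    (S : {linear L -> L}) : L2 -> L :=
  nabla2 \o tmap (tmap (S \o phi t) id) id \o tmap tauhat id \o
  assocl (L := {fset B}) \o tmap id Delta.

Definition rho t (tauhat : {linear L2 -> L2}) (Delta : {linear L -> L2})
    (S : {linear L -> L}) : L2 -> L2 :=
  tmap (phi t) (lambdaR t tauhat Delta S) \o assocr (L := {fset B}) \o
  tmap tauhat id \o assocl (L := {fset B}) \o tmap id Delta.

Definition fEF E F : L2 := tens (fE K E) (fE K F).

(* E' = exch E G H and F' = exch F H G. *)
Definition exch E G H : {fset B} := E `\` G `|` H.

(* The coefficients of rho f_{E,F} at the basis vectors f_{F',E'}; for        *)
(* G `<=` E `\` F and H `<=` F `\` E the pair (F', E') determines (G, H).     *)
Definition rcoef t (tauhat : {linear L2 -> L2}) (Delta : {linear L -> L2})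
    (S : {linear L -> L}) E G F H : K :=
  (-1) ^+ (#|` E| * #|` F|) *
  (rho t tauhat Delta S (fEF E F))@_(exch F H G, exch E G H).

Definition qpoch (x p : K) (n : nat) : K := \prod_(i < n) (1 - x * p ^+ i).

Definition beta p E G F H : K :=
  (-1) ^+ (theta F E + theta (exch F H G) (exch E G H)) *
  p ^+ (theta (G `|` (E `&` F)) E + theta (F `\` E `\` H) (exch E G H)) *
  \prod_(g <- G)
    (p ^ ((theta [fset g] H)%:Z - (theta [fset g] G)%:Z) - 1).

Definition idx_inj G H : bool :=
  [&& (#|` G| <= #|` H|)%N,
      injectiveb (fun g : G => theta [fset val g] H)
    & [forall g : G, (0 < theta [fset val g] H)%N]].

(* The nonzero terms of rho f_{E,F} are indexed by idx, not by the stronger   *)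
(* idx_inj: for B = {1 < 2 < 3 < 4}, G = E = {3, 4} and H = F = {1, 2}, the   *)
(* function g |-> theta_{{g},H} is constant on G, but rho f_{E,F} has the     *)
(* coefficient t^2 p (p - 1) (p^2 - 1) at f_{F',E'} = f_{E,F}.  idx asks that *)
(* all the exponents of p in the last product of beta be positive.            *)
Definition idx G H : bool :=
  (#|` G| <= #|` H|)%N &&
  [forall g : G, (theta [fset val g] G < theta [fset val g] H)%N].

Lemma idx_inj_idx G H : idx_inj G H -> idx G H.
Proof.
case/and3P=> cGH /injectiveP injH /forallP H_gt0; rewrite /idx cGH /=.
apply/forallP => g.
have theta1 x A : theta [fset x] A = (\sum_(y <- A) (y < x)%O)%N.
  by rewrite /theta big_seq_fset1.
pose s := [seq x <- G | (x < val g)%O].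
have -> : theta [fset val g] G = size s.
  rewrite theta1 size_filter -sum1_count [RHS]big_mkcond.
  by apply: eq_bigr => y _; case: (y < val g)%O.
have inj x y : x \in G -> y \in G ->
    theta [fset x] H = theta [fset y] H -> x = y.
  by move=> xG yG /(injH [` xG] [` yG])/(congr1 val).
have us : uniq [seq theta [fset x] H | x <- s].
  rewrite map_inj_in_uniq ?filter_uniq ?fset_uniq // => x y.
  by rewrite !mem_filter => /andP[_ xG] /andP[_ yG]; apply: inj.
have sub : {subset [seq theta [fset x] H | x <- s] <=
            iota 1 (theta [fset val g] H).-1}.
  move=> n /mapP[x]; rewrite mem_filter => /andP[x_lt_g xG] ->.
  rewrite mem_iota add1n (prednK (H_gt0 g)) (H_gt0 [` xG]) /= ltn_neqAle.
  apply/andP; split.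
    by apply: contraTneq x_lt_g => /(inj _ _ xG (valP g)) ->; rewrite ltxx.
  rewrite !theta1; apply: leq_sum => y _.
  by case: (ltP y x) => // /lt_trans/(_ x_lt_g) ->.
have := uniq_leq_size us sub.
by rewrite size_map size_iota -ltnS (prednK (H_gt0 g)).
Qed.

End BraidedHopf.

(* Main.v *)
(* In the braided tensor square of Lambda = Lambda_p(V) one has
     (1 (x) x) Delta(y) = (id (x) nabla)(tauhat (x) id)(x (x) Delta y),
   and Delta is multiplicative, so T(x, y) := (1 (x) x) Delta(y) satisfies
   T(x, y v) = T(x, y) Delta(v) for v in V.  Since nabla tauhat = p^(m n) nabla
   in bidegree (m, n), the antipode is (-1)^n p^(n (n - 1) / 2) in degree n and
   lambda_R(x (x) y) = (t p^|x|; p)_|y| x y.  Hence rho is T rescaled by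
   t^i (t p^|x|; p)_(j - |x|) in bidegree (i, j).  The coefficients of
   T(f_E, f_F) are computed by adding to F its largest element, which turns the
   multiplication by Delta(v) into two identities between the products over G.
   Those products vanish unless all their exponents are positive, because the
   exponents start at a nonnegative value and drop by at most one along G. *)
Require Import Defs.
From HB Require Import structures.
From mathcomp Require Import all_boot all_order all_algebra.
From mathcomp Require Import finmap monalg.
From mathcomp Require Import ring zify.

Set Implicit Arguments.
Unset Strict Implicit.
Unset Printing Implicit Defensive.

Import Order.TTheory GRing.Theory.

Local Open Scope fset_scope.
Local Open Scope ring_scope.

(* Neither [tauhat] nor [Delta] is constructed: their values are forced by the defining equations,
   mainly through the two hexagon rules that result from putting the unit into one of four tensor
   slots. A largest element v of F is split off for two reasons. The product f_F v carries no sign,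
   and all of F lies below v, so for g > v the exponents in the product over G depend only on
   cardinalities: that part is a q-falling factorial, and the sum over the vectors exchanged with v
   becomes a geometric series. The recursion runs on the sets X = F' and Y = E', because
   multiplication by Delta(v) changes these by single elements, while its effect on G and H depends
   on where v lies. The braiding produces powers of p that count elements of Y, the formula has
   powers that count elements of E, G and H; the two agree because X and Y together contain each
   basis vector as often as E and F do. Exponents are integers since factors after a vanishing one
   may have negative exponents; adding them uses [p != 0]. *)
#[local] Opaque lin GRing.scale.

(** * Linear extension, supports and tensor products of maps *)

Section LinearExtension.
Variable K : fieldType.

Lemma eq_lin_supp (I : choiceType) (M : lmodType K) (phi psi : I -> M) x :
  {in msupp x, phi =1 psi} -> lin phi x = lin psi x.
Proof.
move=> e; rewrite (linEw phi (fsubset_refl _)) (linEw psi (fsubset_refl _)).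
by apply: eq_big_seq => i ix; rewrite e.
Qed.

Lemma eq_lin (I : choiceType) (M : lmodType K) (phi psi : I -> M) :
  phi =1 psi -> lin phi =1 lin psi.
Proof. by move=> e x; apply: eq_lin_supp => i _. Qed.

Lemma linE (I : choiceType) (M : lmodType K) (phi : I -> M) x :
  lin phi x = \sum_(i <- msupp x) x@_i *: phi i.
Proof. exact: linEw (fsubset_refl _). Qed.

Lemma lin_U (I : choiceType) (x : {malg K[I]}) : lin (fun i => << i >>) x = x.
Proof.
by rewrite linE [RHS]monalgE; apply: eq_bigr => i _; rewrite malgU_scale.
Qed.

Lemma linear_lin (I : choiceType) (M N : lmodType K) (f : {linear M -> N})
    (phi : I -> M) x : f (lin phi x) = lin (fun i => f (phi i)) x.
Proof.
by rewrite !linE linear_sum; apply: eq_bigr => i _; rewrite linearZ_LR.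
Qed.

Lemma linear_linU (I : choiceType) (M : lmodType K)
    (f : {linear {malg K[I]} -> M}) x : f x = lin (fun i => f << i >>) x.
Proof. by rewrite -{1}[x]lin_U linear_lin. Qed.

(* Restated so that the module structures are syntactically those inferred on
   {malg K[J]}: rewriting with the general lemmas is very slow. *)
Lemma mscalerA (J : choiceType) a b (v : {malg K[J]}) :
  a *: (b *: v) = (a * b) *: v.
Proof. exact: scalerA. Qed.

Lemma mscalerDl (J : choiceType) (v : {malg K[J]}) a b :
  (a + b) *: v = a *: v + b *: v.
Proof. exact: scalerDl. Qed.

Lemma mlinearZ (I J : choiceType)
    (f : {linear {malg K[I]} -> {malg K[J]}}) c x : f (c *: x) = c *: f x.
Proof. exact: linearZ_LR. Qed.

Lemma mscaleNr (J : choiceType) c (v : {malg K[J]}) :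
  - c *: v = - (c *: v).
Proof. exact: scaleNr. Qed.

Lemma mscale1r (J : choiceType) (v : {malg K[J]}) : 1 *: v = v.
Proof. exact: scale1r. Qed.

Lemma mscalerN (J : choiceType) c (v : {malg K[J]}) :
  c *: - v = - (c *: v).
Proof. exact: scalerN. Qed.

Lemma linZf (I J : choiceType) c (phi : I -> {malg K[J]}) x :
  lin (fun i => c *: phi i) x = c *: (lin phi x : {malg K[J]}).
Proof.
rewrite !linE scaler_sumr; apply: eq_bigr => i _.
by rewrite !scalerA mulrC.
Qed.

Lemma linDf (I J : choiceType) (phi psi : I -> {malg K[J]}) x :
  lin (fun i => phi i + psi i) x = lin phi x + lin psi x.
Proof.
by rewrite !linE -big_split; apply: eq_bigr => i _; rewrite scalerDr.
Qed.

Lemma exchange_lin (I J : choiceType) (M : lmodType K) (phi : I -> J -> M) x y :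
  lin (fun i => lin (phi i) y) x = lin (fun j => lin (phi^~ j) x) y.
Proof.
rewrite linE [RHS]linE.
under eq_bigr do rewrite linE scaler_sumr.
rewrite exchange_big; apply: eq_bigr => j _ /=.
rewrite linE scaler_sumr; apply: eq_bigr => i _.
by rewrite !scalerA mulrC.
Qed.

Lemma mcoeff_lin (I J : choiceType) (phi : I -> {malg K[J]}) x j :
  (lin phi x)@_j = \sum_(i <- msupp x) x@_i * (phi i)@_j.
Proof. by rewrite linE raddf_sum; apply: eq_bigr => i _;
  rewrite /= mcoeffZ. Qed.

(** Homogeneity is phrased as a condition on supports, so that [eq_lin_supp] can replace
    degree-dependent scalars by constants. *)
Definition supp (I : choiceType) (P : pred I) (x : {malg K[I]}) :=
  {in msupp x, forall i, P i}.

Lemma suppU (I : choiceType) (P : pred I) i : P i -> supp P (<< i >> : {malg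
  K[I]}).
Proof. by move=> Pi j; rewrite msuppU oner_eq0 inE => /eqP->. Qed.

Lemma supp0 (I : choiceType) (P : pred I) : supp P (0 : {malg K[I]}).
Proof. by move=> j; rewrite msupp0 inE. Qed.

Lemma suppZ (I : choiceType) (P : pred I) c (x : {malg K[I]}) :
  supp P x -> supp P (c *: x).
Proof.
move=> Px j; rewrite -mcoeff_neq0 mcoeffZ => cx; apply: Px.
by rewrite -mcoeff_neq0; apply: contraNneq cx => ->; rewrite mulr0.
Qed.

Lemma suppD (I : choiceType) (P : pred I) (x y : {malg K[I]}) :
  supp P x -> supp P y -> supp P (x + y).
Proof.
move=> Px Py j /(fsubsetP (msuppD_le x y)); rewrite inE.
by case/orP; [apply: Px|apply: Py].
Qed.

Lemma supp_lin (I J : choiceType) (P : pred I) (Q : pred J)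
    (phi : I -> {malg K[J]}) x :
  supp P x -> (forall i, P i -> supp Q (phi i)) -> supp Q (lin phi x).
Proof.
move=> Px Pphi; rewrite linE big_seq.
apply: (big_ind (supp Q)); [exact: supp0|exact: suppD|] => i ix.
by apply/suppZ/Pphi/Px.
Qed.

HB.instance Definition _ (I J I' J' : choiceType)
  (f : {malg K[I]} -> {malg K[I']}) (g : {malg K[J]} -> {malg K[J']}) :=
  GRing.Linear.on (tmap f g).

HB.instance Definition _ (I J L : choiceType) :=
  GRing.Linear.on (@assocl K I J L).

HB.instance Definition _ (I J L : choiceType) :=
  GRing.Linear.on (@assocr K I J L).

HB.instance Definition _ (I : choiceType)
    (g : {malg K[(I * I)%type]} -> {malg K[(I * I)%type]}) :=
  GRing.Linear.on (tmid g).

Definition rtens (I J : choiceType) (y : {malg K[J]}) (x : {malg K[I]}) :=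
  tens x y.

Fact rtens_is_linear (I J : choiceType) (y : {malg K[J]}) :
  linear (@rtens I J y).
Proof. by move=> c x z; rewrite /rtens /tens linearP. Qed.

HB.instance Definition _ (I J : choiceType) (y : {malg K[J]}) :=
  GRing.isLinear.Build K {malg K[I]} {malg K[(I * J)%type]} _ (rtens y)
    (rtens_is_linear y).

Lemma tensUl (I J : choiceType) (i : I) (y : {malg K[J]}) :
  tens << i >> y = lin (fun j => << (i, j) >>) y.
Proof. by rewrite /tens linU. Qed.

Lemma tensUr (I J : choiceType) (x : {malg K[I]}) (j : J) :
  tens x << j >> = lin (fun i => << (i, j) >>) x.
Proof. by rewrite /tens; apply: eq_lin => i; rewrite linU. Qed.

Lemma tensZl (I J : choiceType) c (x : {malg K[I]}) (y : {malg K[J]}) :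
  tens (c *: x) y = c *: tens x y.
Proof. exact: (linearZ_LR (rtens y)). Qed.

Lemma tensZr (I J : choiceType) c (x : {malg K[I]}) (y : {malg K[J]}) :
  tens x (c *: y) = c *: tens x y.
Proof. exact: (linearZ_LR (tens x)). Qed.

Lemma tens0l (I J : choiceType) (y : {malg K[J]}) :
  tens (0 : {malg K[I]}) y = 0.
Proof. exact: (linear0 (rtens y)). Qed.

Lemma tens0r (I J : choiceType) (x : {malg K[I]}) :
  tens x (0 : {malg K[J]}) = 0.
Proof. exact: (linear0 (tens x)). Qed.

Lemma tmapU (I J I' J' : choiceType) (f : {malg K[I]} -> {malg K[I']})
    (g : {malg K[J]} -> {malg K[J']}) i j :
  tmap f g << (i, j) >> = tens (f << i >>) (g << j >>).
Proof. by rewrite /tmap linU. Qed.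

Lemma tmap_tens (I J I' J' : choiceType)
    (f : {linear {malg K[I]} -> {malg K[I']}})
    (g : {linear {malg K[J]} -> {malg K[J']}}) x y :
  tmap f g (tens x y) = tens (f x) (g y).
Proof.
have h i : tmap f g (tens << i >> y) = tens (f << i >>) (g y).
  have := linear_ext (f := tmap f g \o tens << i >>)
                     (g := tens (f << i >>) \o g).
  by move=> /(_ _ y); apply=> j /=; rewrite tensUU tmapU.
have := linear_ext (f := tmap f g \o rtens y) (g := rtens (g y) \o f).
by move=> /(_ _ x); apply=> i /=; apply: h.
Qed.

Lemma tmap_lin (X I J I' J' : choiceType) (f : {malg K[I]} -> {malg K[I']})
    (g : {malg K[J]} -> {malg K[J']}) (phi : X -> {malg K[(I * J)%type]}) x :
  tmap f g (lin phi x) = lin (fun i => tmap f g (phi i)) x.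
Proof. exact: (linear_lin (tmap f g)). Qed.

Lemma tmid_lin (X I : choiceType)
    (g : {malg K[(I * I)%type]} -> {malg K[(I * I)%type]})
    (phi : X -> {malg K[((I * I) * (I * I))%type]}) x :
  tmid g (lin phi x) = lin (fun i => tmid g (phi i)) x.
Proof. exact: (linear_lin (tmid g)). Qed.

Lemma tmidU (I : choiceType)
    (g : {malg K[(I * I)%type]} -> {malg K[(I * I)%type]}) i j k l :
  tmid g << ((i, j), (k, l)) >> =
  lin (fun bc => << ((i, bc.1), (bc.2, l)) >>) (g << (j, k) >>).
Proof. by rewrite /tmid linU. Qed.

Lemma assoclU (I J L : choiceType) i j k :
  @assocl K I J L << (i, (j, k)) >> = << (i, j, k) >>.
Proof. by rewrite /assocl linU. Qed.

Lemma assocrU (I J L : choiceType) i j k :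
  @assocr K I J L << (i, j, k) >> = << (i, (j, k)) >>.
Proof. by rewrite /assocr linU. Qed.

Lemma assocr_lin (X I J L : choiceType)
    (phi : X -> {malg K[(I * J * L)%type]}) x :
  assocr (lin phi x) = lin (fun i => assocr (phi i)) x.
Proof. exact: (linear_lin (@assocr K I J L)). Qed.

End LinearExtension.

#[local] Opaque tens inV tmap tmid assocl assocr.

(** * Induction on the largest element *)

Section MaxInduction.
Context {d : Order.disp_t} {B : orderType d}.
Implicit Types E F G H : {fset B}.

(** Mirror image of [fset_min_ind]: a largest vector is appended on the right without a sign, as a
    smallest one is prepended on the left. *)
Lemma fset_max_ind (P : {fset B} -> Prop) :
  P fset0 ->
  (forall b E, (forall c, c \in E -> (c < b)%O) -> P E -> P (b |` E)) ->
  forall E, P E.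
Proof.
move=> P0 PU E; have [s] : {s | sorted (fun x y => y < x)%O s & E = [fset x in
  s]}.
  exists (rev (sort <=%O E)).
    by rewrite rev_sorted sort_lt_sorted fset_uniq.
  by apply/fsetP => x; rewrite !inE mem_rev mem_sort.
elim: s E => [|b s IHs] E /=; first by move=> _ ->; rewrite fset_nil.
have tr : transitive (fun x y : B => y < x)%O.
  by move=> y x z yx zy; apply: lt_trans zy yx.
move=> bs ->; rewrite fset_cons; apply: PU => [c|].
  by rewrite inE => cs; move: bs; rewrite (path_sortedE tr) => /andP[/allP ->].
exact/IHs/erefl/(path_sorted bs).
Qed.

End MaxInduction.

(* Sealed copies of fE, fEF, tens and wedge: the failing unifications of
   rewrite would otherwise unfold the finitely supported sums. *)
HB.lock Definition e1 (d : Order.disp_t) (B : orderType d) (K : fieldType)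
  (E : {fset B}) : {malg K[{fset B}]} := fE K E.

HB.lock Definition e2 (d : Order.disp_t) (B : orderType d) (K : fieldType)
  (E F : {fset B}) : {malg K[({fset B} * {fset B})%type]} := fEF E F.

HB.lock Definition tn (d : Order.disp_t) (B : orderType d) (K : fieldType)
  (x y : {malg K[{fset B}]}) : {malg K[({fset B} * {fset B})%type]} := tens x y.

HB.lock Definition wd (d : Order.disp_t) (B : orderType d) (K : fieldType)
  (x y : {malg K[{fset B}]}) : {malg K[{fset B}]} := wedge x y.

Arguments e1 {d B K} E.
Arguments e2 {d B K} E F.
Arguments tn {d B K} x y.
Arguments wd {d B K} x y.

HB.lock Definition lmul (d : Order.disp_t) (B : orderType d) (K : fieldType)
  (a : {malg K[{fset B}]}) (u : {malg K[({fset B} * {fset B})%type]}) :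
  {malg K[({fset B} * {fset B})%type]} := tmap (wd a) idfun u.

HB.lock Definition rmul (d : Order.disp_t) (B : orderType d) (K : fieldType)
  (b : {malg K[{fset B}]}) (u : {malg K[({fset B} * {fset B})%type]}) :
  {malg K[({fset B} * {fset B})%type]} := tmap idfun (wd^~ b) u.

Arguments lmul {d B K} a u.
Arguments rmul {d B K} b u.

(** * The monomial basis of the tensor square and bidegrees *)

Section TensorBasis.
Context {d : Order.disp_t} {B : orderType d} {K : fieldType}.
Implicit Types E F G H : {fset B}.

Local Notation L := {malg K[{fset B}]}.
Local Notation L2 := {malg K[({fset B} * {fset B})%type]}.

Definition rwd (y x : L) : L := wd x y.

Lemma e1E E : e1 E = fE K E :> L. Proof. by rewrite e1.unlock. Qed.
Lemma e2E E F : e2 E F = fEF E F :> L2. Proof. by rewrite e2.unlock. Qed.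
Lemma tnE (x y : L) : tn x y = tens x y. Proof. by rewrite tn.unlock. Qed.
Lemma wdE (x y : L) : wd x y = wedge x y. Proof. by rewrite wd.unlock. Qed.

Fact wd_is_linear (x : L) : linear (wd x).
Proof. by move=> c y z; rewrite !wdE linearP. Qed.

HB.instance Definition _ x :=
  GRing.isLinear.Build K L L _ (wd x) (wd_is_linear x).

Fact rwd_is_linear (y : L) : linear (rwd y).
Proof. by move=> c x z; rewrite /rwd !wdE; apply: (linearP (rwedge y)). Qed.

HB.instance Definition _ y :=
  GRing.isLinear.Build K L L _ (rwd y) (rwd_is_linear y).

Lemma wdZr c (x y : L) : wd x (c *: y) = c *: wd x y.
Proof. exact: (linearZ_LR (wd x)). Qed.

Lemma wdZl c (x y : L) : wd (c *: x) y = c *: wd x y.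
Proof. exact: (linearZ_LR (rwd y)). Qed.

Lemma wdA : associative (@wd d B K).
Proof. by move=> x y z; rewrite !wdE wedgeA. Qed.

Lemma wd1l : left_id (e1 fset0) (@wd d B K).
Proof. by move=> x; rewrite wdE e1E wedge1l. Qed.

Lemma wd1r : right_id (e1 fset0) (@wd d B K).
Proof. by move=> x; rewrite wdE e1E wedge1r. Qed.

Lemma wdEE E F : wd (e1 E) (e1 F) =
  (if [disjoint E & F]%fset then (-1) ^+ theta E F *: e1 (E `|` F) else 0) :> L.
Proof. by rewrite wdE !e1E wedgeUU. Qed.

Lemma inVE (b : B) : inV << b >> = e1 [fset b] :> L.
Proof. by rewrite inVU e1E. Qed.

Lemma wd11C a b : wd (e1 [fset a]) (e1 [fset b]) =
  - wd (e1 [fset b]) (e1 [fset a]) :> L.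
Proof. by have := wedge_inVC (K := K) << a >> << b >>;
  rewrite 2!inVE -2!wdE. Qed.

Lemma wd11 a : wd (e1 [fset a]) (e1 [fset a]) = 0 :> L.
Proof. by rewrite wdE -inVE wedge_inV_sq. Qed.

Lemma wd_min b E : (forall c, c \in E -> (b < c)%O) ->
  wd (e1 [fset b]) (e1 E) = e1 (b |` E) :> L.
Proof. by move=> ltbE; rewrite wdE !e1E wedgeU_min. Qed.

Lemma wd_max b E : (forall c, c \in E -> (c < b)%O) ->
  wd (e1 E) (e1 [fset b]) = e1 (b |` E) :> L.
Proof.
move=> ltEb; rewrite wdEE fdisjointX1.
have -> : b \notin E by apply/negP => /ltEb; rewrite ltxx.
rewrite /theta big_seq big1 ?expr0 ?scale1r 1?fsetUC // => c /ltEb.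
by rewrite big_seq_fset1; case: ltgtP.
Qed.

Lemma tnEE E F : tn (e1 E) (e1 F) = e2 E F :> L2.
Proof. by rewrite tnE !e1E e2E. Qed.

Lemma lin_e1 (M : lmodType K) (phi : {fset B} -> M) E : lin phi (e1 E : L) =
  phi E.
Proof. by rewrite e1E lin_fE. Qed.

Lemma lin_e2 (M : lmodType K) (phi : {fset B} * {fset B} -> M) E F :
  lin phi (e2 E F : L2) = phi (E, F).
Proof. by rewrite e2E /fEF /fE tensUU linU. Qed.

Lemma lin_id1 (x : L) : lin (@e1 d B K) x = x.
Proof. by rewrite -[RHS]lin_U; apply: eq_lin => E; rewrite e1E. Qed.

Lemma lin_id2 (u : L2) : lin (fun EF => e2 EF.1 EF.2) u = u.
Proof.
rewrite -[RHS]lin_U; apply: eq_lin => -[E F].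
by rewrite e2E /fEF /fE tensUU.
Qed.

Lemma linear_lin1 (M : lmodType K) (f : {linear L -> M}) x :
  f x = lin (fun E => f (e1 E)) x.
Proof. by rewrite -{1}[x]lin_id1 linear_lin. Qed.

Lemma linear_lin2 (M : lmodType K) (f : {linear L2 -> M}) u :
  f u = lin (fun EF => f (e2 EF.1 EF.2)) u.
Proof. by rewrite -{1}[u]lin_id2 linear_lin. Qed.

Lemma linear_ext2 (M : lmodType K) (f g : {linear L2 -> M}) :
  (forall E F, f (e2 E F) = g (e2 E F)) -> f =1 g.
Proof.
move=> fg u; rewrite linear_lin2 [RHS]linear_lin2.
by apply: eq_lin => -[E F]; apply: fg.
Qed.

Lemma supp1 (P : pred {fset B}) E : P E -> supp P (e1 E : L).
Proof. by rewrite e1E; apply: suppU. Qed.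

Lemma supp2 (P : pred ({fset B} * {fset B})) E F : P (E, F) -> supp P (e2 E F :
  L2).
Proof. by rewrite e2E /fEF /fE tensUU; apply: suppU. Qed.

Lemma tn_e1l E (x : L) : tn (e1 E) x = lin (fun F => e2 E F) x.
Proof.
rewrite tnE e1E /fE tensUl; apply: eq_lin => F.
by rewrite e2E /fEF /fE tensUU.
Qed.

Lemma tn_e1r E (x : L) : tn x (e1 E) = lin (fun F => e2 F E) x.
Proof.
rewrite tnE e1E /fE tensUr; apply: eq_lin => F.
by rewrite e2E /fEF /fE tensUU.
Qed.

Lemma tmid_e2 (g : L2 -> L2) E F G H :
  tmid g (tens (e2 E F) (e2 G H)) =
  lin (fun FG => tens (e2 E FG.1) (e2 FG.2 H)) (g (e2 F G)).
Proof.
rewrite !e2E /fEF /fE !tensUU tmidU; apply: eq_lin => -[F' G'].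
by rewrite !e2E /fEF /fE !tensUU.
Qed.

Lemma inV2E (a b : B) : tmap inV inV << (a, b) >> = e2 [fset a] [fset b] :> L2.
Proof. by rewrite tmapU !inVE -tnEE tnE. Qed.

Lemma nabla_tn (x y : L) : nabla (tn x y) = wd x y :> L.
Proof. by rewrite tnE wdE. Qed.

Lemma nablaE E F : nabla (e2 E F) = wd (e1 E) (e1 F) :> L.
Proof. by rewrite -tnEE nabla_tn. Qed.

Fact lmul_is_linear (a : L) : linear (lmul a).
Proof. by move=> c u v; rewrite lmul.unlock linearP. Qed.

HB.instance Definition _ a :=
  GRing.isLinear.Build K L2 L2 _ (lmul a) (lmul_is_linear a).

Fact rmul_is_linear (b : L) : linear (rmul b).
Proof. by move=> c u v; rewrite rmul.unlock linearP. Qed.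

HB.instance Definition _ b :=
  GRing.isLinear.Build K L2 L2 _ (rmul b) (rmul_is_linear b).

Lemma lmul_tn (a x y : L) : lmul a (tn x y) = tn (wd a x) y.
Proof. by rewrite lmul.unlock !tnE; apply: (tmap_tens (wd a) idfun). Qed.

Lemma rmul_tn (b x y : L) : rmul b (tn x y) = tn x (wd y b).
Proof. by rewrite rmul.unlock !tnE; apply: (tmap_tens idfun (rwd b)). Qed.

Lemma lmulE (a : L) E F : lmul a (e2 E F) = tn (wd a (e1 E)) (e1 F).
Proof. by rewrite -tnEE lmul_tn. Qed.

Lemma rmulE (b : L) E F : rmul b (e2 E F) = tn (e1 E) (wd (e1 F) b).
Proof. by rewrite -tnEE rmul_tn. Qed.

Lemma lmulC (a b : L) u : lmul a (rmul b u) = rmul b (lmul a u).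
Proof.
have := linear_ext2 (f := lmul a \o rmul b) (g := rmul b \o lmul a).
by move=> /(_ _ u); apply=> E F /=; rewrite rmulE lmulE lmul_tn rmul_tn.
Qed.

Lemma rmul1 (u : L2) : rmul (e1 fset0) u = u.
Proof.
have := linear_ext2 (f := rmul (e1 fset0)) (g := idfun).
by move=> /(_ _ u); apply=> E F /=; rewrite rmulE wd1r tnEE.
Qed.

Lemma rmulA (b b' : L) u : rmul b' (rmul b u) = rmul (wd b b') u.
Proof.
have := linear_ext2 (f := rmul b' \o rmul b) (g := rmul (wd b b')).
by move=> /(_ _ u); apply=> E F /=; rewrite !rmulE rmul_tn wdA.
Qed.

Lemma nabla_lmul (a : L) u : nabla (lmul a u) = wd a (nabla u).
Proof.
have := linear_ext2 (f := nabla \o lmul a) (g := wd a \o nabla).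
by move=> /(_ _ u); apply=> E F /=; rewrite lmulE nabla_tn nablaE wdA.
Qed.

Lemma nabla_rmul (b : L) u : nabla (rmul b u) = wd (nabla u) b.
Proof.
have := linear_ext2 (f := nabla \o rmul b) (g := rwd b \o nabla).
by move=> /(_ _ u); apply=> E F /=; rewrite rmulE nabla_tn nablaE /rwd wdA.
Qed.

Definition degs m n : L2 -> Prop := supp (fun EF : {fset B} * {fset B} =>
  (#|` EF.1| == m) && (#|` EF.2| == n)).

Lemma supp_wd E F :
  supp (fun G => #|` G| == #|` E| + #|` F|)%N (wd (e1 E) (e1 F) : L).
Proof.
rewrite wdEE; case: ifP => dEF; last exact: supp0.
apply/suppZ/supp1/eqP.
by have := cardfsUI E F; rewrite (eqP dEF) cardfs0 addn0.
Qed.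

Lemma degs_lmul m n E u : degs m n u -> degs (#|` E| + m)%N n (lmul (e1 E) u).
Proof.
move=> du; rewrite linear_lin2; apply: (supp_lin du) => -[F G] /= /andP[/eqP<-
  /eqP<-].
rewrite lmulE tn_e1r; apply: (supp_lin (@supp_wd E F)) => H /= /eqP eH.
by apply: supp2; rewrite /= eH !eqxx.
Qed.

Lemma degs_rmul m n E u : degs m n u -> degs m (n + #|` E|)%N (rmul (e1 E) u).
Proof.
move=> du; rewrite linear_lin2; apply: (supp_lin du) => -[F G] /= /andP[/eqP<-
  /eqP<-].
rewrite rmulE tn_e1l; apply: (supp_lin (@supp_wd G E)) => H /= /eqP eH.
by apply: supp2; rewrite /= eH !eqxx.
Qed.

End TensorBasis.

(** * Hexagon rules, degrees of the braiding, and its composite with the product *)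

Section Braiding.
Context {d : Order.disp_t} {B : orderType d} {K : fieldType}.
Implicit Types E F G H : {fset B}.

Local Notation L := {malg K[{fset B}]}.
Local Notation L2 := {malg K[({fset B} * {fset B})%type]}.
Local Notation e_ E := (@e1 d B K E).
Local Notation "E # F" := (@e2 d B K E F) (at level 30, no associativity).

Context {p : K} {tauhat : {linear L2 -> L2}}.
Context (tauhatP : is_braiding p tauhat).

Lemma tauhat1l F : tauhat (fset0 # F) = F # fset0.
Proof. by case: tauhatP => _ h _ _; rewrite -!tnEE !tnE !(e1E fset0) h. Qed.

Lemma tauhat1r F : tauhat (F # fset0) = fset0 # F.
Proof. by case: tauhatP => _ _ h _; rewrite -!tnEE !tnE !(e1E fset0) h. Qed.

Lemma tauhat11 a b : tauhat ([fset a] # [fset b]) =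
  if a == b then - ([fset a] # [fset a])
  else if (b < a)%O
  then - (1 - p) *: ([fset a] # [fset b]) - [fset b] # [fset a]
  else - p *: ([fset b] # [fset a]).
Proof.
case: tauhatP => h _ _ _; rewrite -inV2E h /tau linU.
case: eqP => _; first by rewrite linearN /= inV2E.
case: ifP => _; last by rewrite linearZ_LR /= inV2E.
by rewrite linearB linearZ_LR /= !inV2E.
Qed.

Lemma tmid_fset0 u F : tmap nabla nabla (tmid tauhat (tens u (fset0 # F))) =
  rmul (e_ F) u.
Proof.
have := linear_ext2
  (f := tmap nabla nabla \o tmid tauhat \o rtens (fset0 # F))
  (g := rmul (e_ F)).
move=> /(_ _ u); apply=> G H.
rewrite /= /rtens tmid_e2 tauhat1r lin_e2 /= tmap_tens /= -tnE !nablaE rmulE.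
by rewrite wd1r.
Qed.

Lemma tmid_fset1 u F : tmap nabla nabla (tmid tauhat (tens (F # fset0) u)) =
  lmul (e_ F) u.
Proof.
have := linear_ext2
  (f := tmap nabla nabla \o tmid tauhat \o tens (F # fset0))
  (g := lmul (e_ F)).
move=> /(_ _ u); apply=> G H.
rewrite /= tmid_e2 tauhat1l lin_e2 /= tmap_tens /= -tnE !nablaE lmulE.
by rewrite wd1l.
Qed.

(** Hexagon rule: the fourth slot of the compatibility with products is filled with the unit, which
    crosses trivially, so only two crossings remain. *)
Lemma tauhat_wedgel E F G : tauhat (tn (wd (e_ E) (e_ F)) (e_ G)) =
  lin (fun HF => rmul (e_ HF.2) (tauhat (E # HF.1))) (tauhat (F # G)).
Proof.
case: tauhatP => _ _ _ /(_ (tens (E # F) (G # fset0))).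
rewrite tmap_tens /= !nablaE wd1r -tnE => ->.
rewrite tmid_e2 (tmap_lin tauhat) tmid_lin (tmap_lin nabla nabla).
apply: eq_lin => -[H F'] /=.
by rewrite tmap_tens tauhat1r tmid_fset0.
Qed.

Lemma tauhat_wedger E F G : tauhat (tn (e_ E) (wd (e_ F) (e_ G))) =
  lin (fun FE => lmul (e_ FE.1) (tauhat (FE.2 # G))) (tauhat (E # F)).
Proof.
case: tauhatP => _ _ _ /(_ (tens (fset0 # E) (F # G))).
rewrite tmap_tens /= !nablaE wd1l -tnE => ->.
rewrite tmid_e2 (tmap_lin tauhat) tmid_lin (tmap_lin nabla nabla).
apply: eq_lin => -[H F'] /=.
by rewrite tmap_tens tauhat1l tmid_fset1.
Qed.

(** Peeling the smallest vector off E lets the induction hypothesis act first; the last crossing is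
    between two single vectors, where [tau] is explicit. *)
Lemma degs_tauhat1 E b : degs 1%N #|` E| (tauhat (E # [fset b])).
Proof.
elim/(@fset_min_ind d B): E => [|a E ltaE IHE].
  by rewrite tauhat1l; apply: supp2; rewrite /= cardfs1 !eqxx.
have aE : a \notin E by apply/negP => /ltaE; rewrite ltxx.
rewrite -tnEE -(wd_min ltaE) tauhat_wedgel cardfsU1 aE.
apply: (supp_lin IHE) => -[G H] /= /andP[/cardfs1P[c ->] /eqP<-].
apply: (degs_rmul (m := 1%N) (n := 1%N)); rewrite tauhat11.
case: ifP => _; last case: ifP => _.
- rewrite -scaleN1r; apply/suppZ/supp2.
  by rewrite /= cardfs1.
- rewrite -scaleN1r.
  by apply: suppD; apply/suppZ/supp2; rewrite /= !cardfs1.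
- by apply/suppZ/supp2; rewrite /= !cardfs1.
Qed.

Lemma degs_tauhat E F : degs #|` F| #|` E| (tauhat (E # F)).
Proof.
elim/(@fset_max_ind d B): F => [|b F ltFb IHF].
  by rewrite tauhat1r; apply: supp2; rewrite /= !eqxx.
have bF : b \notin F by apply/negP => /ltFb; rewrite ltxx.
rewrite -tnEE -(wd_max ltFb) tauhat_wedger cardfsU1 bF addnC.
apply: (supp_lin IHF) => -[G H] /= /andP[/eqP<- /eqP<-].
exact/degs_lmul/degs_tauhat1.
Qed.

(** For a > b anticommutation turns -(1 - p) ab - ba into p ab, for a < b it turns -p ba into p ab,
    and for a = b both sides vanish. *)
Lemma nabla_tauhat11 a b : nabla (tauhat ([fset a] # [fset b])) =
  p *: wd (e_ [fset a]) (e_ [fset b]).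
Proof.
rewrite tauhat11; case: eqP => [<-|_]; last case: ifP => _.
- by rewrite linearN /= nablaE wd11 oppr0 scaler0.
- rewrite linearB linearZ_LR /= !nablaE (wd11C b a) opprK scaleNr scalerBl
  scale1r.
  by rewrite opprB subrK.
- by rewrite linearZ_LR /= nablaE (wd11C b a) scalerN scaleNr opprK.
Qed.

Lemma nabla_tauhat1 E b : nabla (tauhat (E # [fset b])) =
  p ^+ #|` E| *: wd (e_ E) (e_ [fset b]).
Proof.
elim/(@fset_min_ind d B): E => [|a E ltaE IHE].
  by rewrite tauhat1l nablaE wd1r wd1l cardfs0 expr0 scale1r.
have aE : a \notin E by apply/negP => /ltaE; rewrite ltxx.
rewrite -tnEE -(wd_min ltaE) tauhat_wedgel cardfsU1 aE add1n.
rewrite linear_lin exprS -mscalerA -wdA -wdZr -IHE.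
rewrite [nabla (tauhat _) in RHS]linear_lin2 linear_lin -linZf.
apply: eq_lin_supp => -[G H] /(@degs_tauhat1 E b) /= /andP[/cardfs1P[c ->] _].
rewrite nabla_rmul nabla_tauhat11 nablaE wdZl wdA.
reflexivity.
Qed.

Lemma nabla_tauhat E F : nabla (tauhat (E # F)) =
  p ^+ (#|` E| * #|` F|) *: wd (e_ E) (e_ F).
Proof.
elim/(@fset_max_ind d B): F => [|b F ltFb IHF].
  by rewrite tauhat1r nablaE wd1r wd1l cardfs0 muln0 expr0 scale1r.
have bF : b \notin F by apply/negP => /ltFb; rewrite ltxx.
rewrite -tnEE -(wd_max ltFb) tauhat_wedger cardfsU1 bF mulnDr muln1.
rewrite linear_lin exprD -mscalerA wdA -wdZl -IHF.
rewrite [nabla (tauhat _) in RHS]linear_lin2.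
rewrite -[wd _ (e_ [fset b])]/(rwd (e_ [fset b]) _) linear_lin -linZf.
apply: eq_lin_supp => -[G H] /(@degs_tauhat E F) /= /andP[_ /eqP<-].
by rewrite nabla_lmul nabla_tauhat1 nablaE wdZr wdA; congr (_ *: _).
Qed.

End Braiding.

(* In the braided tensor square, mulDelta v (below) is the right product by
   Delta v, mulDelta1 v its part by v (x) 1, and braid_mul E u is the product
   (1 (x) f_E) u. *)
HB.lock Definition mulDelta1 (d : Order.disp_t) (B : orderType d)
  (K : fieldType)
  (tauhat : {linear {malg K[({fset B} * {fset B})%type]} ->
                    {malg K[({fset B} * {fset B})%type]}}) (v : B) :
  {malg K[({fset B} * {fset B})%type]} -> {malg K[({fset B} * {fset B})%type]}
  :=
  lin (fun EF => lmul (e1 EF.1) (tauhat (e2 EF.2 [fset v]))).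

HB.lock Definition braid_mul (d : Order.disp_t) (B : orderType d)
  (K : fieldType)
  (tauhat : {linear {malg K[({fset B} * {fset B})%type]} ->
                    {malg K[({fset B} * {fset B})%type]}}) (E : {fset B}) :
  {malg K[({fset B} * {fset B})%type]} -> {malg K[({fset B} * {fset B})%type]}
  :=
  lin (fun FG => rmul (e1 FG.2) (tauhat (e2 E FG.1))).

Arguments mulDelta1 {d B K} tauhat v u : rename.
Arguments braid_mul {d B K} tauhat E u : rename.

(** * The coproduct through right multiplication by Delta(v) *)

Section Comultiplication.
Context {d : Order.disp_t} {B : orderType d} {K : fieldType}.
Implicit Types E F G H : {fset B}.

Local Notation L := {malg K[{fset B}]}.
Local Notation L2 := {malg K[({fset B} * {fset B})%type]}.
Local Notation e_ E := (@e1 d B K E).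
Local Notation "E # F" := (@e2 d B K E F) (at level 30, no associativity).

Context {p : K} {tauhat : {linear L2 -> L2}} {Delta : {linear L -> L2}}.
Context (tauhatP : is_braiding p tauhat) (DeltaP : is_coproduct tauhat Delta).

Fact mulDelta1_is_linear v : linear (mulDelta1 tauhat v).
Proof. by move=> c x y; rewrite mulDelta1.unlock linearP. Qed.

HB.instance Definition _ v :=
  GRing.isLinear.Build K L2 L2 _ (mulDelta1 tauhat v) (mulDelta1_is_linear v).

Definition mulDelta (v : B) (u : L2) : L2 := mulDelta1 tauhat v u + rmul (e_
  [fset v]) u.

Fact mulDelta_is_linear v : linear (mulDelta v).
Proof. by move=> c x y; rewrite /mulDelta !linearP scalerDr addrACA. Qed.

HB.instance Definition _ v :=
  GRing.isLinear.Build K L2 L2 _ (mulDelta v) (mulDelta_is_linear v).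

Fact braid_mul_is_linear E : linear (braid_mul tauhat E).
Proof. by move=> c x y; rewrite braid_mul.unlock linearP. Qed.

HB.instance Definition _ E :=
  GRing.isLinear.Build K L2 L2 _ (braid_mul tauhat E) (braid_mul_is_linear E).

Local Notation mulDelta1 := (mulDelta1 tauhat).
Local Notation braid_mul := (braid_mul tauhat).

Lemma mulDelta1E v E F : mulDelta1 v (E # F) = lmul (e_ E) (tauhat (F # [fset
  v])).
Proof. by rewrite mulDelta1.unlock lin_e2. Qed.

Lemma mulDeltaE v E F : mulDelta v (E # F) =
  lmul (e_ E) (tauhat (F # [fset v])) + rmul (e_ [fset v]) (E # F).
Proof. by rewrite /mulDelta mulDelta1E. Qed.

Lemma braid_mulE E F G : braid_mul E (F # G) = rmul (e_ G) (tauhat (E # F)).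
Proof. by rewrite braid_mul.unlock lin_e2. Qed.

Lemma Delta0 : Delta (e_ fset0) = fset0 # fset0.
Proof. by case: DeltaP => h _ _; rewrite -tnEE tnE !e1E h. Qed.

(** The summand v (x) 1 must cross the second tensor factor, hence the [tauhat] in [mulDelta1]; the
    summand 1 (x) v crosses only the unit. *)
Lemma Delta_wd E v : Delta (wd (e_ E) (e_ [fset v])) = mulDelta v (Delta (e_
  E)).
Proof.
case: DeltaP => _ hV /(_ (E # [fset v])).
rewrite nablaE => ->.
have hv : Delta (e_ [fset v]) = [fset v] # fset0 + fset0 # [fset v].
  by rewrite -inVE hV !inVE -(e1E fset0) -!tnE !tnEE.
rewrite -tnEE tnE tmap_tens /= hv.
have := linear_ext2
  (f := tmap nabla nabla \o tmid tauhat
          \o rtens ([fset v] # fset0 + fset0 # [fset v])) (g := mulDelta v).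
move=> /(_ _ (Delta (e_ E))); apply=> F G.
rewrite /= /rtens linearD 2!linearD /= mulDeltaE; apply: f_equal2.
  rewrite tmid_e2 tmap_lin [RHS]linear_lin2.
  apply: eq_lin => -[H H'] /=.
  by rewrite tmap_tens /= !nablaE wd1r -tnE lmulE.
rewrite tmid_e2 (tauhat1r tauhatP) lin_e2 /=.
by rewrite tmap_tens /= !nablaE wd1r -tnE rmulE.
Qed.

Lemma Delta_max E v : (forall c, c \in E -> (c < v)%O) ->
  Delta (e_ (v |` E)) = mulDelta v (Delta (e_ E)).
Proof. by move=> ltEv; rewrite -(wd_max ltEv) Delta_wd. Qed.

Lemma rmul_lin x u : rmul x u = lin (fun G => rmul (e_ G) u) x.
Proof.
rewrite linear_lin2.
under [RHS]eq_lin => G do rewrite linear_lin2.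
rewrite exchange_lin; apply: eq_lin => -[E F] /=.
rewrite rmulE tn_e1l [wd _ x]linear_lin1.
have := linear_lin (lin (fun H => E # H)) (fun G => wd (e_ F) (e_ G)) x.
by move=> ->; apply: eq_lin => G; rewrite rmulE tn_e1l.
Qed.

Lemma braid_mul_tnl E F x : braid_mul E (tn (e_ F) x) = rmul x (tauhat (E # F)).
Proof.
rewrite tn_e1l (linear_lin (braid_mul E)) rmul_lin; apply: eq_lin => G /=.
by rewrite braid_mulE.
Qed.

Lemma braid_mul_tnr E G x : braid_mul E (tn x (e_ G)) = rmul (e_ G) (tauhat (tn
  (e_ E) x)).
Proof.
rewrite tn_e1r tn_e1l (linear_lin (braid_mul E)) (linear_lin tauhat) linear_lin.
by apply: eq_lin => F /=; rewrite braid_mulE.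
Qed.

Lemma mulDelta1_tn v E x : mulDelta1 v (tn (e_ E) x) =
  lmul (e_ E) (tauhat (tn x (e_ [fset v]))).
Proof.
rewrite tn_e1r tn_e1l (linear_lin (mulDelta1 v)) (linear_lin tauhat) linear_lin.
by apply: eq_lin => F /=; rewrite mulDelta1E.
Qed.

(** An instance of associativity in the braided tensor square, obtained directly from the two
    hexagon rules. *)
Lemma braid_mul_mulDelta E v u : braid_mul E (mulDelta v u) = mulDelta v
  (braid_mul E u).
Proof.
have := linear_ext2 (f := braid_mul E \o mulDelta v) (g := mulDelta v \o
  braid_mul E).
move=> /(_ _ u); apply=> F G /=.
rewrite mulDeltaE (linearD (braid_mul E)) (braid_mulE E F G) /mulDelta.
rewrite /=; apply: f_equal2; last first.
  by rewrite rmulE rmulA braid_mul_tnl.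
(* Common value of both orders for the part v (x) 1: E crosses F and G crosses v independently, then
   the resulting inner strands cross each other. The left side reaches it with [tauhat_wedger], the
   right side with [tauhat_wedgel]. *)
transitivity (lin (fun VG => lin (fun FE =>
    lmul (e_ FE.1) (rmul (e_ VG.2) (tauhat (FE.2 # VG.1)))) (tauhat (E # F)))
  (tauhat (G # [fset v]))).
  etransitivity; first exact: (linear_lin2 (braid_mul E \o lmul (e_ F))).
  apply: eq_lin => -[V' G'] /=.
  rewrite lmulE braid_mul_tnr (tauhat_wedger tauhatP) (linear_lin (rmul (e_
    G'))).
  by apply: eq_lin => -[F' E'] /=; rewrite lmulC.
rewrite exchange_lin; apply/esym.
etransitivity; first exact: (linear_lin2 (mulDelta1 v \o rmul (e_ G))).
apply: eq_lin => -[F' E'] /=.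
rewrite rmulE mulDelta1_tn (tauhat_wedgel tauhatP).
exact: (linear_lin (lmul (e_ F'))).
Qed.

Lemma braid_mul0 E : braid_mul E (fset0 # fset0) = fset0 # E.
Proof. by rewrite braid_mulE (tauhat1r tauhatP) rmul1. Qed.

Lemma braid_mul_Delta_max E F v : (forall c, c \in F -> (c < v)%O) ->
  braid_mul E (Delta (e_ (v |` F))) = mulDelta v (braid_mul E (Delta (e_ F))).
Proof. by move=> ltFv; rewrite Delta_max // braid_mul_mulDelta. Qed.

Lemma degs_mulDelta m v u :
  supp (fun EF : {fset B} * {fset B} => #|` EF.1| + #|` EF.2| == m)%N u ->
  supp (fun EF : {fset B} * {fset B} => #|` EF.1| + #|` EF.2| == m.+1)%N
    (mulDelta v u).
Proof.
move=> du; rewrite linear_lin2; apply: (supp_lin du) => -[E F] /= /eqP<-.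
rewrite mulDeltaE; apply: suppD => G.
  move=> /(degs_lmul (E := E) (degs_tauhat1 tauhatP (E := F) (b := v))).
  by case/andP=> /eqP-> /eqP->; apply/eqP; rewrite /=; lia.
have dEF : degs #|` E| #|` F| (E # F) by apply: supp2; rewrite /= !eqxx.
move=> /(degs_rmul (E := [fset v]) dEF).
by rewrite cardfs1 => /andP[/eqP-> /eqP->]; apply/eqP; rewrite /=; lia.
Qed.

Lemma degs_Delta F : supp
  (fun EF : {fset B} * {fset B} => #|` EF.1| + #|` EF.2| == #|` F|)%N
  (Delta (e_ F)).
Proof.
elim/(@fset_max_ind d B): F => [|v F ltFv IHF].
  by rewrite Delta0; apply: supp2.
have vF : v \notin F by apply/negP => /ltFv; rewrite ltxx.
by rewrite Delta_max // cardfsU1 vF add1n; apply: degs_mulDelta.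
Qed.

End Comultiplication.

Arguments mulDelta {d B K} tauhat v u.

(** * The antipode, the right action and rho *)

HB.lock Definition rescale (d : Order.disp_t) (B : orderType d)
  (K : fieldType) (J : choiceType) (c : nat -> nat -> K)
  (f : {malg K[({fset B} * {fset B})%type]} -> {malg K[J]}) :
  {malg K[({fset B} * {fset B})%type]} -> {malg K[J]} :=
  lin (fun EF : {fset B} * {fset B} =>
    c #|` EF.1| #|` EF.2| *: f (e2 EF.1 EF.2)).

Arguments rescale {d B K J} c f u : rename.

Section Antipode.
Context {d : Order.disp_t} {B : orderType d} {K : fieldType}.
Implicit Types E F G H : {fset B}.

Local Notation L := {malg K[{fset B}]}.
Local Notation L2 := {malg K[({fset B} * {fset B})%type]}.
Local Notation e_ E := (@e1 d B K E).
Local Notation "E # F" := (@e2 d B K E F) (at level 30, no associativity).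

Fact rescale_is_linear (J : choiceType) c (f : L2 -> {malg K[J]}) :
  linear (rescale c f).
Proof. by move=> a x y; rewrite rescale.unlock linearP. Qed.

HB.instance Definition _ (J : choiceType) c (f : L2 -> {malg K[J]}) :=
  GRing.isLinear.Build K L2 {malg K[J]} _ (rescale c f) (rescale_is_linear c f).

Lemma rescaleE (J : choiceType) c (f : {linear L2 -> {malg K[J]}}) m n u :
  degs m n u -> rescale c f u = c m n *: f u.
Proof.
move=> du; rewrite rescale.unlock (linear_lin2 f u) -linZf.
by apply: eq_lin_supp => -[E F] /du /= /andP[/eqP-> /eqP->].
Qed.

Lemma degsE E F : degs #|` E| #|` F| (E # F).
Proof. by apply: supp2; rewrite /= !eqxx. Qed.

Context {p : K} {tauhat : {linear L2 -> L2}} {Delta : {linear L -> L2}}.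
Context {S : {linear L -> L}}.
Context (tauhatP : is_braiding p tauhat) (DeltaP : is_coproduct tauhat Delta).
Context (SP : is_antipode Delta S).

(** Equal to (-1)^n p^(n (n - 1) / 2); as a product it gains exactly the factor -p^n when the degree
    grows from n to n + 1. *)
Definition antipode_coef n : K := \prod_(i < n) - p ^+ i.

(* At z = 1 this is the convolution of the antipode with the identity, before
   the antipode is known. *)
Definition qnabla (z : K) : L2 -> L :=
  rescale (fun m _ => z ^+ m * antipode_coef m) nabla.

HB.instance Definition _ z := GRing.Linear.on (qnabla z).

(** The 1 comes from 1 (x) v. For v (x) 1 the first degree grows by one, which costs -z p^|E|, and
    moving v across f_F costs p^|F|. *)
Lemma qnabla_mulDelta z v E F : qnabla z (mulDelta tauhat v (E # F)) =
  (1 - z * p ^+ (#|` E| + #|` F|)) *: wd (qnabla z (E # F)) (e_ [fset v]).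
Proof.
rewrite mulDeltaE (linearD (qnabla z)) /= /qnabla.
rewrite (rescaleE _ _ (@degsE E F)).
rewrite (rescaleE _ _
  (degs_lmul (E := E) (degs_tauhat1 tauhatP (E := F) (b := v)))).
rewrite (rescaleE _ _ (degs_rmul (E := [fset v]) (@degsE E F))).
rewrite /= nabla_lmul nabla_rmul (nabla_tauhat1 tauhatP) nablaE.
rewrite wdZr wdA wdZl !mscalerA -mscalerDl; apply: (f_equal2 (@GRing.scale _
  _));
  last reflexivity.
by rewrite /antipode_coef addn1 big_ord_recr exprSr exprD /=; ring.
Qed.

(** Used at two values: at z = 1 the first factor vanishes in positive degree, which identifies the
    antipode, and z = t p^|E| gives the scalar of lambda_R. *)
Lemma qnabla_Delta z F : qnabla z (Delta (e_ F)) = qpoch z p #|` F| *: e_ F.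
Proof.
elim/(@fset_max_ind d B): F => [|v F ltFv IHF].
  rewrite (Delta0 DeltaP) /qnabla (rescaleE _ _ (@degsE _ _)) /= nablaE wd1r.
  by rewrite ?cardfs0 /antipode_coef /qpoch !big_ord0 mulr1.
have vF : v \notin F by apply/negP => /ltFv; rewrite ltxx.
rewrite (Delta_max tauhatP DeltaP ltFv) cardfsU1 vF add1n.
have -> : qnabla z (mulDelta tauhat v (Delta (e_ F))) =
    (1 - z * p ^+ #|` F|) *: wd (qnabla z (Delta (e_ F))) (e_ [fset v]).
  rewrite [LHS](linear_lin2 (qnabla z \o mulDelta tauhat v)).
  rewrite [in RHS](linear_lin2 (qnabla z)).
  rewrite -/(rwd _ _) (linear_lin (rwd (e_ [fset v]))) -linZf.
  apply: eq_lin_supp => -[E G] /(degs_Delta tauhatP DeltaP) /= /eqP <-.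
  exact: qnabla_mulDelta.
rewrite IHF wdZl (wd_max ltFv) mscalerA mulrC /qpoch.
rewrite [in RHS]big_ord_recr; reflexivity.
Qed.

(** On Delta f_F it isolates the terms whose first factor has full degree, the only ones out of
    reach of the induction hypothesis in [antipodeE]. *)
Definition id_counit : L2 -> L :=
  lin (fun EF : {fset B} * {fset B} => if EF.2 == fset0 then e_ EF.1 else 0).

HB.instance Definition _ := GRing.Linear.on id_counit.

Lemma id_counit_degs m n u : degs m n.+1 u -> id_counit u = 0.
Proof.
move=> du; transitivity (lin (fun=> 0 : L) u); last first.
  by rewrite linE big1 // => i _; rewrite scaler0.
apply: eq_lin_supp => -[E F] /du /= /andP[_ cF].
by rewrite ifN //; apply: contraTneq cF => ->; rewrite cardfs0.
Qed.

Lemma id_counit_tn x : id_counit (tn x (e_ fset0)) = x.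
Proof.
rewrite tn_e1r (linear_lin id_counit) -[RHS]lin_id1; apply: eq_lin => E /=.
by rewrite /id_counit lin_e2 eqxx.
Qed.

Lemma id_counit_mulDelta v u : id_counit (mulDelta tauhat v u) = wd (id_counit
  u) (e_ [fset v]).
Proof.
have := linear_ext2 (f := id_counit \o mulDelta tauhat v) (g := rwd (e_ [fset
  v]) \o id_counit).
move=> /(_ _ u); apply=> E F /=.
rewrite mulDeltaE (linearD id_counit) /= {3}/id_counit lin_e2 /=.
have := degs_rmul (E := [fset v]) (@degsE E F).
rewrite cardfs1 addn1 => /id_counit_degs->; rewrite addr0.
case: eqP => [->|/eqP F0].
  by rewrite (tauhat1l tauhatP) lmulE id_counit_tn.
rewrite (linear0 (rwd (e_ [fset v]))).
have := degs_lmul (E := E) (degs_tauhat1 tauhatP (E := F) (b := v)).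
by move: F0; rewrite -cardfs_gt0; case: #|` F| => // n _ /id_counit_degs.
Qed.

Lemma id_counit_Delta F : id_counit (Delta (e_ F)) = e_ F.
Proof.
elim/(@fset_max_ind d B): F => [|v F ltFv IHF].
  by rewrite (Delta0 DeltaP) -tnEE id_counit_tn.
by rewrite (Delta_max tauhatP DeltaP ltFv) id_counit_mulDelta IHF (wd_max ltFv).
Qed.

Lemma counitE F : counit (e_ F) = (F == fset0)%:R.
Proof. by rewrite /counit e1E mcoeffU. Qed.

Lemma tmap_lin2 (f g : L -> L) u :
  tmap f g u = lin (fun EF => tn (f (e_ EF.1)) (g (e_ EF.2))) u.
Proof.
rewrite [LHS](linear_linU (tmap f g)); apply: eq_lin => -[E F].
by rewrite /= tmapU tnE !e1E.
Qed.

Lemma antipodeE F : S (e_ F) = antipode_coef #|` F| *: e_ F.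
Proof.
have [n] := ubnP #|` F|; elim: n F => // n IHn F; rewrite ltnS => leFn.
have [->|F0] := eqVneq F fset0.
  have [/(_ (e_ fset0)) + _] := SP.
  rewrite (Delta0 DeltaP) tmap_lin2 lin_e2 /= nabla_tn wd1r counitE eqxx => ->.
  rewrite -e1E; apply: (f_equal (fun c => c *: e_ fset0)).
  by rewrite /antipode_coef ?cardfs0 big_ord0.
have [/(_ (e_ F)) + _] := SP; rewrite counitE (negPf F0) scale0r tmap_lin2.
rewrite (linear_lin nabla) => SF.
have WF : qnabla 1 (Delta (e_ F)) = 0.
  move: F0; rewrite qnabla_Delta -cardfs_gt0 /qpoch; case: #|` F| => // m _.
  by rewrite big_ord_recl /= expr0 mulr1 subrr mul0r scale0r.
(* [T] is the defect of the claimed formula. Terms of Delta f_F with a nontrivial second factor have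
   a first factor of smaller degree, where S is known, so the convolution for S and [qnabla 1]
   differ by [T] on the remaining part. *)
pose T := lin (fun E => S (e_ E) - antipode_coef #|` E| *: e_ E).
suff: T (id_counit (Delta (e_ F))) = 0.
  by rewrite id_counit_Delta /T lin_e1 => /eqP; rewrite subr_eq0 => /eqP.
transitivity (lin (fun EF => nabla (tn (S (e_ EF.1)) (e_ EF.2)))
    (Delta (e_ F)) + -1 *: qnabla 1 (Delta (e_ F))); last first.
  by rewrite WF scaler0 addr0; exact: SF.
rewrite /qnabla rescale.unlock -linZf -linDf.
etransitivity; first exact: (linear_lin2 (T \o id_counit)).
apply: eq_lin_supp => -[E G] /(degs_Delta tauhatP DeltaP) /= /eqP cEG.
rewrite /id_counit lin_e2 /= expr1n mul1r nabla_tn nablaE scaleN1r.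
case: eqP => [->|/eqP G0]; first by rewrite !wd1r /T lin_e1.
rewrite (linear0 T) IHn ?wdZl ?subrr //.
by apply: leq_trans leFn; rewrite -cEG -addn1 leq_add2l cardfs_gt0.
Qed.

Lemma mcoeff_scale (I : choiceType) (c : I -> K) (u : {malg K[I]}) j :
  (lin (fun i => c i *: << i >>) u)@_j = c j * u@_j.
Proof.
rewrite mcoeff_lin -[X in _ * X@_j]lin_U mcoeff_lin mulr_sumr.
apply: eq_bigr => i _; rewrite mcoeffZ mcoeffU.
by case: eqP => [->|_]; rewrite ?mulr0 // mulrCA.
Qed.

Lemma phiE t F : phi t (e_ F) = t ^+ #|` F| *: e_ F.
Proof. by rewrite /phi lin_e1 e1E. Qed.

Lemma nabla_Sphi t u : nabla (tmap (S \o phi t) idfun u) =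
  rescale (fun m _ => t ^+ m * antipode_coef m) nabla u.
Proof.
rewrite tmap_lin2 (linear_lin nabla) rescale.unlock.
apply: eq_lin => -[E F] /=.
rewrite phiE (linearZ_LR S) /= antipodeE nabla_tn !wdZl mscalerA.
rewrite nablaE; reflexivity.
Qed.

Lemma tmap_id_Delta E F :
  tmap idfun Delta (E # F) = tens (e_ E) (Delta (e_ F)).
Proof. by rewrite e2E /fEF /fE tensUU tmapU /= !e1E. Qed.

Lemma tmap_assocl_tens E (u : L2) :
  tmap tauhat idfun (assocl (L := {fset B}) (tens (e_ E) u)) =
  lin (fun FG => tens (tauhat (E # FG.1)) (e_ FG.2)) u.
Proof.
have := linear_ext2
  (f := tmap tauhat idfun \o assocl (L := {fset B}) \o tens (e_ E))
  (g := lin (fun FG => tens (tauhat (E # FG.1)) (e_ FG.2))).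
move=> /(_ _ u); apply=> F G /=.
rewrite lin_e2 /= !e2E !e1E /fEF /fE !tensUU assoclU tmapU; reflexivity.
Qed.

Lemma lambdaR_unfold t u : lambdaR t tauhat Delta S u =
  nabla (tmap nabla idfun (tmap (tmap (S \o phi t) idfun) idfun
    (tmap tauhat idfun (assocl (L := {fset B}) (tmap idfun Delta u))))).
Proof. reflexivity. Qed.

Lemma rho_unfold t u : rho t tauhat Delta S u =
  tmap (phi t) (lambdaR t tauhat Delta S) (assocr (L := {fset B})
    (tmap tauhat idfun (assocl (L := {fset B}) (tmap idfun Delta u)))).
Proof. reflexivity. Qed.

(** A term f_G (x) f_H of Delta f_F contributes t^|G| and the antipode coefficient of degree |G|
    through S phi_t, and p^(|E| |G|) through the braiding: together the weight of [qnabla] at z = t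
    p^|E|. *)
Lemma lambdaRE t E F : lambdaR t tauhat Delta S (E # F) =
  qpoch (t * p ^+ #|` E|) p #|` F| *: wd (e_ E) (e_ F).
Proof.
rewrite lambdaR_unfold tmap_id_Delta tmap_assocl_tens.
pose g := nabla \o (tmap nabla idfun \o tmap (tmap (S \o phi t) idfun) idfun).
etransitivity; first exact: (linear_lin g).
transitivity (wd (e_ E) (qnabla (t * p ^+ #|` E|) (Delta (e_ F)))); last first.
  by rewrite qnabla_Delta wdZr; reflexivity.
rewrite /qnabla rescale.unlock; apply/esym.
etransitivity; first exact: (linear_lin (wd (e_ E))).
apply: eq_lin => -[G H] /=.
rewrite !tmap_tens /= nabla_Sphi (rescaleE _ _ (degs_tauhat tauhatP (E := E) (F
  := G))).
rewrite /= (nabla_tauhat tauhatP) mscalerA -tnE nabla_tn wdZl wdZr nablaE wdA.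
apply: (f_equal2 (@GRing.scale _ _)); last reflexivity.
by rewrite exprMn -exprM; ring.
Qed.

Lemma tmap_assocr_tens (f : L -> L) (g : L2 -> L) u H :
  tmap f g (assocr (L := {fset B}) (tens u (e_ H))) =
  lin (fun XY => tens (f (e_ XY.1)) (g (XY.2 # H))) u.
Proof.
rewrite e1E /fE tensUr assocr_lin (tmap_lin f g); apply: eq_lin => -[X Y].
rewrite /= assocrU tmapU !e1E e2E /fEF /fE tensUU; reflexivity.
Qed.

(** Here lambda_R acts on a factor of degree |E| and on f_H, whose degree is read off the second
    degree n as n - |E|. On the support f_H has been appended to that factor, so the subtraction is
    exact. *)
Lemma rhoE t E F : rho t tauhat Delta S (E # F) =
  rescale (fun m n => t ^+ m * qpoch (t * p ^+ #|` E|) p (n - #|` E|)) idfun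
    (braid_mul tauhat E (Delta (e_ F))).
Proof.
rewrite rho_unfold tmap_id_Delta tmap_assocl_tens.
rewrite assocr_lin (tmap_lin (phi t)).
rewrite braid_mul.unlock; apply/esym; etransitivity; first exact: linear_lin.
apply: eq_lin => -[G H] /=.
rewrite (rescaleE _ _ (degs_rmul (E := H) (degs_tauhat tauhatP (E := E) (F :=
  G)))).
rewrite /= addKn (linear_lin2 (rmul (e_ H)) (tauhat _)) -linZf.
rewrite tmap_assocr_tens.
apply: eq_lin_supp => -[X Y] /(degs_tauhat tauhatP) /= /andP[/eqP eX /eqP eY].
rewrite rmulE phiE lambdaRE eX eY tnE tensZl tensZr mscalerA.
reflexivity.
Qed.

Lemma mcoeff_rho t E F X Y : (rho t tauhat Delta S (E # F))@_(X, Y) =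
  t ^+ #|` X| * qpoch (t * p ^+ #|` E|) p (#|` Y| - #|` E|) *
  (braid_mul tauhat E (Delta (e_ F)))@_(X, Y).
Proof.
pose c (XY : {fset B} * {fset B}) :=
  t ^+ #|` XY.1| * qpoch (t * p ^+ #|` E|) p (#|` XY.2| - #|` E|).
transitivity ((lin (fun XY => c XY *: << XY >>) (braid_mul tauhat E (Delta (e_
  F))))@_(X, Y)); last exact: mcoeff_scale.
rewrite rhoE rescale.unlock; apply: (f_equal (mcoeff (X, Y)));
  apply: eq_lin => -[G H] /=.
by rewrite e2E /fEF /fE tensUU.
Qed.

End Antipode.

(** * Counting below a vector, and the products over G *)

Section ThetaCount.
Context {d : Order.disp_t} {B : orderType d}.
Implicit Types (A E F G H : {fset B}) (b g v : B).

Local Notation th g A := (theta [fset g] A).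

Lemma th_sum g A : th g A = (\sum_(y <- A) (y < g)%O)%N.
Proof. by rewrite /theta big_seq_fset1. Qed.

Lemma thU1 g b A : b \notin A -> th g (b |` A) = ((b < g)%O + th g A)%N.
Proof. by move=> bA; rewrite !th_sum big_fsetU1. Qed.

Lemma theta_U1l b A E : b \notin A -> theta (b |` A) E = (th b E + theta A E)%N.
Proof. by move=> bA; rewrite thetaUl // fdisjoint1X. Qed.

Lemma theta_U1r b A E : b \notin E ->
  theta A (b |` E) = (theta A [fset b] + theta A E)%N.
Proof. by move=> bE; rewrite thetaUr // fdisjoint1X. Qed.

Lemma theta_r1 A v : theta A [fset v] = (\sum_(a <- A) (v < a)%O)%N.
Proof. by apply: eq_bigr => a _; rewrite big_seq_fset1. Qed.

Lemma th_full g A : (forall y, y \in A -> (y < g)%O) -> th g A = #|` A|.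
Proof.
move=> ltAg; rewrite th_sum big_seq (eq_bigr (fun=> 1%N)) => [|y /ltAg->//].
by rewrite -big_seq sum1_size.
Qed.

Lemma th_empty g A : (forall y, y \in A -> (g <= y)%O) -> th g A = 0%N.
Proof.
by move=> leAg; rewrite th_sum big_seq big1 // => y /leAg; case: ltgtP.
Qed.

Lemma th_mono g b A : (g <= b)%O -> (th g A <= th b A)%N.
Proof.
move=> legb; rewrite !th_sum; apply: leq_sum => y _.
by case: (ltP y g) => // /lt_le_trans/(_ legb) ->.
Qed.

Lemma th_card g A : (th g A <= #|` A|)%N.
Proof.
by rewrite th_sum -sum1_size; apply: leq_sum => y _; case: (_ < _)%O.
Qed.

Lemma theta_r0 A v : (forall a, a \in A -> (a <= v)%O) -> theta A [fset v] =
  0%N.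
Proof.
by move=> leAv; rewrite theta_r1 big_seq big1 // => a /leAv; case: ltgtP.
Qed.

Lemma card_theta v A :
  #|` A| = (theta A [fset v] + th v A + (v \in A))%N.
Proof.
elim/(@fset_max_ind d B): A => [|b A ltAb IHA].
  by rewrite theta0l theta0r inE cardfs0.
have bA : b \notin A by apply/negP => /ltAb; rewrite ltxx.
rewrite cardfsU1 bA IHA theta_U1l // thU1 // !inE
  (th_sum b [fset v]) big_seq_fset1.
case: (ltgtP v b) => [||->]; rewrite ?(negPf bA) /=; try lia.
Qed.

Section Products.
Context {R : fieldType}.

(** For g in A, [th g A] is the rank of g in A. *)
Lemma prod_th A (f : nat -> R) :
  \prod_(g <- A) f (th g A) = \prod_(i < #|` A|) f i.
Proof.
elim/(@fset_max_ind d B): A => [|b A ltAb IHA].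
  by rewrite cardfs0 big_ord0 big_seq_fset0.
have bA : b \notin A by apply/negP => /ltAb; rewrite ltxx.
rewrite cardfsU1 bA big_ord_recr /= -IHA big_fsetU1 //= mulrC.
rewrite thU1 // ltxx th_full //; congr (_ * _).
apply: eq_big_seq => g gA; rewrite thU1 //.
by have := ltAb _ gA; case: ltgtP.
Qed.

Lemma sum_th A (f : nat -> R) :
  \sum_(g <- A) f (th g A) = \sum_(i < #|` A|) f i.
Proof.
elim/(@fset_max_ind d B): A => [|b A ltAb IHA].
  by rewrite cardfs0 big_ord0 big_seq_fset0.
have bA : b \notin A by apply/negP => /ltAb; rewrite ltxx.
rewrite cardfsU1 bA big_ord_recr /= -IHA big_fsetU1 //= addrC.
rewrite thU1 // ltxx th_full //; congr (_ + _).
apply: eq_big_seq => g gA; rewrite thU1 //.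
by have := ltAb _ gA; case: ltgtP.
Qed.

Context {p : R} (p_neq0 : p != 0).

Definition beta_prod G H : R :=
  \prod_(g <- G) (p ^ ((th g H)%:Z - (th g G)%:Z) - 1).

Definition qfalling (M : int) s : R := \prod_(i < s) (p ^ (M - i%:Z) - 1).

(** At g in G2 the exponent is |H| - |G1| minus the rank of g in G2, so the upper part sees only
    cardinalities. *)
Lemma beta_prodU G1 G2 H :
  (forall x y, x \in G1 -> y \in G2 -> (x < y)%O) ->
  (forall x y, x \in H -> y \in G2 -> (x < y)%O) ->
  beta_prod (G1 `|` G2) H = beta_prod G1 H * qfalling (#|` H|%:Z - #|` G1|%:Z)
    #|` G2|.
Proof.
move=> lt12 ltH2; have d12 : [disjoint G1 & G2]%fset.
  by apply/fdisjointP => x x1; apply/negP => /(lt12 _ _ x1); rewrite ltxx.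
rewrite /beta_prod [LHS](perm_big (G1 ++ G2)); last first.
  apply: uniq_perm; rewrite ?fset_uniq ?cat_uniq ?fset_uniq ?andbT //=.
    apply/hasPn => x x2; apply/negP => x1.
    by have := lt12 _ _ x1 x2; rewrite ltxx.
  by move=> x; rewrite inE mem_cat.
rewrite big_cat /=; congr (_ * _).
  apply: eq_big_seq => g g1; rewrite thetaUr // (th_empty (A := G2)) ?addn0 //.
  by move=> y /(lt12 _ _ g1)/ltW.
rewrite /qfalling -(prod_th G2 (fun i => p ^ (_ - i%:Z) - 1)).
apply: eq_big_seq => g g2; rewrite thetaUr // (th_full (A := H)) ?(th_full (A
  := G1)).
- by congr (p ^ _ - 1); rewrite PoszD; ring.
- by move=> y y1; apply: lt12.
- by move=> y yH; apply: ltH2.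
Qed.

Lemma beta_prod_idx G H : beta_prod G H = 0 \/ idx G H.
Proof.
(* The third clause strengthens the induction: it makes the next exponent th v H - |G| nonnegative.
   If that is 0, the new factor p^0 - 1 kills the product; otherwise all clauses persist. *)
suff [|[a b _]] : beta_prod G H = 0 \/ [/\ (#|` G| <= #|` H|)%N,
    forall g, g \in G -> (th g G < th g H)%N &
    forall v, (forall g, g \in G -> (g < v)%O) -> (#|` G| <= th v H)%N].
- by left.
- by right; rewrite /idx a; apply/forallP => g; apply/b/valP.
elim/(@fset_max_ind d B): G => [|b G ltGb IHG].
  by right; split=> // [g|v _]; rewrite ?inE ?cardfs0.
have bG : b \notin G by apply/negP => /ltGb; rewrite ltxx.
have PU : beta_prod (b |` G) H = (p ^ ((th b H)%:Z - #|` G|%:Z) - 1) *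
  beta_prod G H.
  rewrite /beta_prod big_fsetU1 //= thU1 // ltxx (th_full ltGb); congr (_ * _).
  apply: eq_big_seq => g gG; rewrite thU1 //.
  by have := ltGb _ gG; case: ltgtP.
case: IHG => [P0|[leGH ltGH leGv]]; first by left; rewrite PU P0 mulr0.
have leb := leGv _ ltGb.
have [e|nb] := eqVneq (th b H) #|` G|; first by left;
  rewrite PU e subrr expr0z subrr mul0r.
have ltb : (#|` G| < th b H)%N by rewrite ltn_neqAle eq_sym nb.
right; rewrite cardfsU1 bG add1n; split=> [|g|v ltv].
- exact: leq_trans ltb (th_card _ _).
- rewrite !inE thU1 // => /predU1P[->|gG]; first by rewrite ltxx (th_full ltGb).
  by have := ltGb _ gG; case: ltgtP => // _ _; apply: ltGH.
- apply: leq_trans ltb (th_mono _ _); apply/ltW/ltv.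
  by rewrite !inE eqxx.
Qed.

Lemma geom_sum (M : int) s :
  (p - 1) * \sum_(i < s) p ^ (M - i%:Z - 1) = p ^ M - p ^ (M - s%:Z).
Proof.
elim: s => [|s IHs]; first by rewrite big_ord0 mulr0 subr0 subrr.
rewrite big_ord_recr /= mulrDr IHs mulrBl mul1r.
have -> : M - s.+1%:Z = M - s%:Z - 1 by lia.
have -> : p ^ (M - s%:Z) = p * p ^ (M - s%:Z - 1).
  by rewrite -{2}[p]expr1z -expfzDr //; congr (p ^ _); lia.
by ring.
Qed.

Lemma qfalling_recl M s : qfalling (M + 1) s.+1 = (p ^ (M + 1) - 1) * qfalling
  M s.
Proof.
rewrite /qfalling big_ord_recl subr0; congr (_ * _); apply: eq_bigr => i _.
by rewrite /= /bump /=; congr (p ^ _ - 1); lia.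
Qed.

Lemma qfalling_recr M s : qfalling M s.+1 = qfalling M s * (p ^ (M - s%:Z) - 1).
Proof. by rewrite /qfalling big_ord_recr. Qed.

Lemma sum_th_shift G1 G2 (M : int) :
  (forall x y, x \in G1 -> y \in G2 -> (x < y)%O) ->
  \sum_(g <- G2) p ^ (M - (th g (G1 `|` G2))%:Z) =
  \sum_(i < #|` G2|) p ^ (M - #|` G1|%:Z - i%:Z).
Proof.
move=> lt12; have d12 : [disjoint G1 & G2]%fset.
  by apply/fdisjointP => x x1; apply/negP => /(lt12 _ _ x1); rewrite ltxx.
rewrite -(sum_th G2 (fun i => p ^ (M - _ - i%:Z))); apply: eq_big_seq => g g2.
rewrite thetaUr // (th_full (A := G1)) => [|y y1]; last exact: lt12.
by congr (p ^ _); lia.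
Qed.

Section Split.
Context (G1 G2 H : {fset B}) (v : B).
Context (lt1v : forall x, x \in G1 -> (x < v)%O).
Context (ltv2 : forall x, x \in G2 -> (v < x)%O).
Context (ltHv : forall x, x \in H -> (x < v)%O).

Let lt12 x y : x \in G1 -> y \in G2 -> (x < y)%O.
Proof. by move=> x1 y2; apply: lt_trans (lt1v x1) (ltv2 y2). Qed.

Let ltH2 x y : x \in H -> y \in G2 -> (x < y)%O.
Proof. by move=> xH y2; apply: lt_trans (ltHv xH) (ltv2 y2). Qed.

Let M : int := #|` H|%:Z - #|` G1|%:Z.

Lemma beta_prod_rem g : g \in G2 ->
  beta_prod (G1 `|` (G2 `\ g)) H = beta_prod G1 H * qfalling M #|` G2|.-1.
Proof.
move=> g2; rewrite beta_prodU.
- by rewrite [in RHS](cardfsD1 g) g2 add1n.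
- by move=> x y x1; rewrite !inE => /andP[_ y2]; apply: lt12.
- by move=> x y xH; rewrite !inE => /andP[_ y2]; apply: ltH2.
Qed.

(** Only the exponents over G2 change when v joins H, each rising by one, and the products with some
    g removed are all equal. With |G2| = n + 1 and the common factor [beta_prod G1 H * qfalling M n]
    removed, what remains is the geometric sum p^(M+1) - p^(M-n). *)
Lemma beta_prod_U1 :
  beta_prod (G1 `|` G2) (v |` H) = beta_prod (G1 `|` G2) H + (p - 1) *
    \sum_(g <- G2) p ^ (#|` H|%:Z - (th g (G1 `|` G2))%:Z) *
      beta_prod (G1 `|` (G2 `\ g)) H.
Proof.
have vH : v \notin H by apply/negP => /ltHv; rewrite ltxx.
have e1 : beta_prod G1 (v |` H) = beta_prod G1 H.
  apply: eq_big_seq => g /lt1v ltgv; rewrite thU1 //.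
  by move: ltgv; case: ltgtP.
rewrite beta_prodU //; last first.
  by move=> x y; rewrite !inE => /predU1P[->|]; [apply: ltv2|apply: ltH2].
rewrite e1 cardfsU1 vH beta_prodU // -/M.
have -> : (true + #|` H|)%N%:Z - #|` G1|%:Z = M + 1 by rewrite /M; lia.
under eq_big_seq => g g2 do rewrite beta_prod_rem //.
rewrite -mulr_suml sum_th_shift // -/M.
case: #|` G2| => [|n]; first by rewrite big_ord0 mul0r mulr0 addr0 /qfalling
  !big_ord0.
have := geom_sum (M + 1) n.+1.
under eq_bigr => i _ do rewrite addrAC addrK.
rewrite mulrA => ->; rewrite qfalling_recl qfalling_recr /=.
by rewrite (_ : M + 1 - n.+1%:Z = M - n%:Z); [ring | lia].
Qed.

(** With s = |G2|, every product is a multiple of [beta_prod G1 H * qfalling M s], and the identity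
    reads 1 = p^M - (p^(M-s) - 1) - (p^M - p^(M-s)), the last bracket being a geometric sum. *)
Lemma beta_prod_memU1 :
  beta_prod (G1 `|` G2) H =
    p ^ (#|` H|%:Z - (th v (G1 `|` G2))%:Z) * beta_prod (G1 `|` G2) H
    - beta_prod (v |` (G1 `|` G2)) H
    - (p - 1) * \sum_(g <- G2) p ^ (#|` H|%:Z - (th g (G1 `|` G2))%:Z - 1) *
        beta_prod (v |` (G1 `|` (G2 `\ g))) H.
Proof.
have lt12' x y : x \in G1 -> y \in v |` G2 -> (x < y)%O.
  by move=> x1; rewrite !inE => /predU1P[->|]; [apply: lt1v|apply: lt12].
have ltH2' x y : x \in H -> y \in v |` G2 -> (x < y)%O.
  by move=> xH; rewrite !inE => /predU1P[->|]; [apply: ltHv|apply: ltH2].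
have v2 : v \notin G2 by apply/negP => /ltv2; rewrite ltxx.
have d12 : [disjoint G1 & G2]%fset.
  by apply/fdisjointP => x x1; apply/negP => /(lt12 x1); rewrite ltxx.
have rem g : g \in G2 ->
    beta_prod (v |` (G1 `|` (G2 `\ g))) H = beta_prod G1 H * qfalling M #|` G2|.
  move=> g2; rewrite fsetUCA beta_prodU.
  - rewrite cardfsU1 !inE (negPf v2) andbF.
    by rewrite [in RHS](cardfsD1 g) g2.
  - move=> x y x1; rewrite !inE => yp; apply: lt12' => //.
    by rewrite !inE; case/orP: yp => [->|/andP[_ ->]]; rewrite ?orbT.
  - move=> x y x1; rewrite !inE => yp; apply: ltH2' => //.
    by rewrite !inE; case/orP: yp => [->|/andP[_ ->]]; rewrite ?orbT.
under eq_big_seq => g g2 do rewrite rem //.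
rewrite -mulr_suml fsetUCA !beta_prodU // -/M cardfsU1 v2 qfalling_recr.
rewrite thetaUr // (th_full lt1v) (th_empty (A := G2)) ?addn0 => [|y
  /ltv2/ltW//].
rewrite -/M [X in _ - X]mulrA.
have -> : (p - 1) * (\sum_(g <- G2)
    p ^ (#|` H|%:Z - (th g (G1 `|` G2))%:Z - 1)) = p ^ M - p ^ (M - #|` G2|%:Z).
  rewrite -geom_sum.
  under eq_bigr => g _ do rewrite (addrAC #|` H|%:Z).
  rewrite sum_th_shift //; congr (_ * _); apply: eq_bigr => i _.
  by congr (p ^ _); rewrite /M; lia.
by ring.
Qed.

End Split.
End Products.
End ThetaCount.

Arguments beta_prod {d B R} p G H.

(** * Unsigned coefficients and their recursion in F *)

Fact shift_eq (a b c h : nat) :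
  (a + b = c + h)%N -> a%:Z = c%:Z + (h%:Z - b%:Z).
Proof. by lia. Qed.

Fact shift_gt (a b c h x y : nat) : (true + a + b + false = c + h + 1)%N ->
  a%:Z + (x + y)%N%:Z = (c + x + y)%N%:Z + (h%:Z - b%:Z).
Proof. by lia. Qed.

Fact shift_gtX (a b c h x y z : nat) : (true + a + b + true = c + h + 1)%N ->
  a%:Z + (z + x + y)%N%:Z = (z + (c + x + y))%N%:Z + (h%:Z - b%:Z - 1).
Proof. by lia. Qed.

Fact recombine (R : comPzRingType) (a b q x y z c : R) :
  a * b * (q * x - y - c * z) = a * q * (b * x) - (a * b * y + c * (a * b * z)).
Proof. by ring. Qed.

Section Weights.
Context {d : Order.disp_t} {B : orderType d} {K : fieldType}.
Implicit Types (A C E F G H X Y : {fset B}) (b g v : B).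
Local Notation th g A := (theta [fset g] A).

Lemma th_ID g X A : th g X = (th g (X `\` A) + th g (X `&` A))%N.
Proof.
rewrite -thetaUr 1?fsetUC ?fsetID //.
by apply/fdisjointP => x; rewrite !inE => /andP[/negPf ->]; rewrite andbF.
Qed.

(* f_X (x) f_Y has the multidegree of f_E (x) f_F. *)
Definition same_content E F X Y :=
  (X `|` Y == E `|` F) && (X `&` Y == E `&` F).

(** Counting multiplicities makes the condition additive, so that sums over X and Y compare with
    sums over E and F. *)
Lemma same_contentP E F X Y :
  reflect (forall x, (x \in X) + (x \in Y) = (x \in E) + (x \in F))%N
    (same_content E F X Y).
Proof.
apply: (iffP andP) => [[/eqP/fsetP eU /eqP/fsetP eI] x|e].
  move: (eU x) (eI x); rewrite !inE.
  by do 4!case: (x \in _).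
by split; apply/eqP/fsetP => x; move: (e x); rewrite !inE; do 4!case: (x \in _).
Qed.

Lemma same_content_sum E F X Y (f : B -> nat) : same_content E F X Y ->
  (\sum_(x <- X) f x + \sum_(x <- Y) f x = \sum_(x <- E) f x + \sum_(x <- F) f
    x)%N.
Proof.
pose U := X `|` Y `|` (E `|` F).
have sumU A : A `<=` U -> (\sum_(x <- A) f x = \sum_(x <- U) (x \in A) * f x)%N.
  move=> AU; transitivity (\sum_(x <- A) (x \in A) * f x)%N.
    by apply: eq_big_seq => x ->; rewrite mul1n.
  by apply: big_fset_incl => // x _ /negPf->.
move=> /same_contentP e.
rewrite !sumU; try by apply/fsubsetP => x xA; rewrite !inE xA ?orbT.
by rewrite -!big_split; apply: eq_bigr => x _; rewrite /= -!mulnDl e.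
Qed.

Context {p : K} (p_neq0 : p != 0).

(* beta without its sign, as a function of X = F' and Y = E'; then G = X \ F
   and H = F \ X. *)
Definition ubeta E F X Y : K :=
  p ^+ (theta ((X `\` F) `|` (E `&` F)) E + theta ((F `&` X) `\` E) Y) *
  beta_prod p (X `\` F) (F `\` X).

Section Step.
Context (E F X Y : {fset B}) (v : B).
Context (ltFv : forall x, x \in F -> (x < v)%O).
Context (XY : same_content E (v |` F) X Y).

Let vF : v \notin F. Proof. by apply/negP => /ltFv; rewrite ltxx. Qed.

Let memXY x : ((x \in X) + (x \in Y) = (x \in E) + ((x == v) || (x \in F)))%N.
Proof. by have /same_contentP/(_ x) := XY; rewrite !inE. Qed.

Let thFmax g : (v < g)%O -> th g (v |` F) = #|` F|.+1.
Proof.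
move=> ltvg; rewrite th_full ?cardfsU1 ?vF // => y.
by rewrite !inE => /predU1P[->//|/ltFv/lt_trans]; apply.
Qed.

Let thXD g : (v <= g)%O ->
  th g X = (th g (X `\` (v |` F)) + ((v < g)%O && (v \in X)) + #|` F `&` X|)%N.
Proof.
move=> levg; rewrite (th_ID g X (v |` F)) -addnA; congr (_ + _)%N.
have ltFg x : x \in F -> (x < g)%O by move=> /ltFv/lt_le_trans; apply.
have := th_ID g (X `&` (v |` F)) F.
have -> : X `&` (v |` F) `&` F = F `&` X.
  by apply/fsetP => x; rewrite !inE; do 2!case: (x \in _); rewrite ?orbT ?andbF.
rewrite (th_full (A := F `&` X)) => [->|y]; last by rewrite !inE =>
  /andP[/ltFg].
congr (_ + _)%N; have [vX|vX] := boolP (v \in X).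
  have -> : X `&` (v |` F) `\` F = [fset v].
    apply/fsetP => x; rewrite !inE; case: (eqVneq x v) => [->|_] /=.
      by rewrite vF vX.
    by case: (x \in F); rewrite ?andbF.
  by rewrite th_sum big_seq_fset1 andbT.
have -> : X `&` (v |` F) `\` F = fset0; last by rewrite theta0r andbF.
apply/fsetP => x; rewrite !inE; case: (eqVneq x v) => [->|_] /=.
  by rewrite (negPf vX) andbF.
by case: (x \in F); rewrite ?andbF.
Qed.

Let cardF : #|` F| = (#|` F `&` X| + #|` F `\` X|)%N.
Proof. by rewrite (cardfsID X F). Qed.

Let thXY g : (th g X + th g Y = th g E + th g (v |` F))%N.
Proof. by rewrite !th_sum; apply: same_content_sum. Qed.

(** X and Y have as many elements below g as E and [v |] F[have, and]v |[F] lies entirely below g.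
    This trades the power p^(th g Y) left by the braiding for the exponents of the product
    identities. *)
Lemma th_gt g : (v < g)%O ->
  (th g Y + th g (X `\` (v |` F)) + (v \in X) = th g E + #|` F `\` X| + 1)%N.
Proof.
move=> ltvg; have := thXY g; rewrite thFmax // (thXD (ltW ltvg)) ltvg /= cardF.
have arith (a b c n m : nat) (k : bool) :
    (a + k + m + b = c + (m + n).+1 -> b + a + k = c + n + 1)%N by lia.
exact: arith.
Qed.

Lemma th_eq :
  (th v Y + th v (X `\` (v |` F)) = th v E + #|` F `\` X|)%N.
Proof.
have := thXY v; rewrite thU1 // ltxx (th_full ltFv) (thXD (lexx v)) ltxx /=
  cardF.
have arith (a b c n m : nat) :
    (a + 0 + m + b = c + (0 + (m + n)) -> b + a = c + n)%N by lia.
exact: arith.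
Qed.

Let G := X `\` (v |` F).
Let H := F `\` X.
Let D := (F `&` X) `\` E.
Let G1 := [fset g in G | (g < v)%O].
Let G2 := [fset g in G | (v < g)%O].

Let vG : v \notin G. Proof. by rewrite !inE eqxx. Qed.

Let ltHv x : x \in H -> (x < v)%O. Proof. by rewrite inE => /andP[_ /ltFv]. Qed.

Let lt1v x : x \in G1 -> (x < v)%O. Proof. by rewrite !inE => /andP[]. Qed.

Let ltv2 x : x \in G2 -> (v < x)%O. Proof. by rewrite !inE => /andP[]. Qed.

Let G12 : G1 `|` G2 = G.
Proof.
apply/fsetP => x; rewrite 3!inE !(inE, in_fset) /=.
by case: (ltgtP x v) => [||->]; rewrite ?eqxx ?andbT ?andbF ?orbF //=.
Qed.

Let G2P g : (g \in G2) = [&& g \in X, g \notin F & (v < g)%O].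
Proof.
rewrite !inE /= negb_or -!andbA.
by case: (ltgtP g v); rewrite ?andbF ?andbT //= andbC.
Qed.

Let G1D g : g \in G2 -> G1 `|` (G2 `\ g) = G `\ g.
Proof.
move=> g2; rewrite -G12; apply/fsetP => x; rewrite !inE.
case: (eqVneq x g) => [->|_] //=.
by have /ltv2 := g2; case: (ltgtP g v); rewrite ?andbF.
Qed.

(** A vector g > v is outside F; if it lies in X, equality of contents puts it in E and keeps it out
    of Y. *)
Lemma big_gt (f : B -> K) : v \in Y ->
  \sum_(g <- X | (v < g)%O && (g \notin Y)) f g = \sum_(g <- G2) f g.
Proof.
move=> vY; rewrite big_fset_condE.
suff -> : [fset g in X | (v < g)%O && (g \notin Y)] = G2 by [].
apply/fsetP => g; rewrite G2P !inE /=; have [gX|//] := boolP (g \in X).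
rewrite /= andbC; have := memXY g; rewrite gX.
have [ltvg|] := boolP (v < g)%O; rewrite ?andbF ?andbT //.
have /negPf-> : g \notin F by apply/negP => /ltFv/lt_trans/(_ ltvg);
  rewrite ltxx.
have /negPf-> : g != v by apply: contraTneq ltvg => ->; rewrite ltxx.
by case: (g \in Y) => //; case: (g \in E).
Qed.

Let C := E `&` F.
Let Z := Y `\ v.
Let e := (theta (G `|` C) E + theta D Z)%N.

Let vF0 : (v \in F) = false. Proof. exact: negPf vF. Qed.

Let ltDv a : a \in D -> (a < v)%O. Proof. by rewrite !inE => /andP[_
  /andP[/ltFv]]. Qed.

(** Here v enters neither G nor H but F \ E \ H, whose theta against Y grows by th v Y. *)
Lemma ubeta_stepX : v \in X -> (v \in Y) = false -> (v \in E) = false ->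
  ubeta E (v |` F) X Y = p ^+ th v Y * ubeta E F (X `\ v) Y.
Proof.
move=> vX vY vE; rewrite /ubeta mulrA -exprD.
have -> : X `\ v `\` F = X `\` (v |` F).
  apply/fsetP => x; rewrite !inE; have [->|_] /= := eqVneq x v.
    by rewrite andbF.
  by [].
have -> : E `&` (v |` F) = E `&` F.
  by apply/fsetP => x; rewrite !inE; have [->|_] := eqVneq x v; rewrite ?vE.
have -> : (v |` F) `\` X = F `\` (X `\ v).
  apply/fsetP => x; rewrite !inE; have [->|_] := eqVneq x v => //.
  by rewrite vX vF0.
have -> : (v |` F) `&` X `\` E = v |` (F `&` (X `\ v) `\` E).
  apply/fsetP => x; rewrite !inE; have [->|_] := eqVneq x v => //=.
  by rewrite vX vE.
rewrite theta_U1l ?inE ?vF0 ?eqxx ?andbF //.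
by congr (p ^+ _ * _); rewrite addnCA.
Qed.

Let thetaDg g : (v <= g)%O -> g \notin Z -> theta D (g |` Z) = theta D Z.
Proof.
move=> levg gZ; rewrite theta_U1r // theta_r0 // => a /ltDv.
by move=> /lt_le_trans/(_ levg)/ltW.
Qed.

Let g2F g : g \in G2 -> (g \in F) = false.
Proof. by rewrite G2P => /and3P[_ /negPf]. Qed.

Let g2v g : g \in G2 -> (g == v) = false.
Proof. by move=> /ltv2; case: eqVneq => // ->; rewrite ltxx. Qed.

Let g2Z g : g \in G2 -> g \notin Z.
Proof.
move=> g2; have := memXY g; have := g2; rewrite G2P => /and3P[-> _ _].
rewrite g2F // g2v // !inE g2v //=.
by case: (g \in Y) => //; case: (g \in E).
Qed.

Let theta_rem g : g \in G2 ->
  (th g E + theta (G `\ g `|` C) E = theta (G `|` C) E)%N.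
Proof.
move=> g2; rewrite -theta_U1l ?inE ?g2F ?andbF ?eqxx //.
have gG : g \in G by rewrite -G12 inE g2 orbT.
by rewrite fsetUA fsetD1K.
Qed.

Let Drem g : g \in G2 -> (F `&` (X `\ g)) `\` E = D.
Proof.
move=> g2; apply/fsetP => x; rewrite !inE; have [->|_] := eqVneq x g => //=.
by rewrite g2F //.
Qed.

Let Hrem g : g \in G2 -> F `\` (X `\ g) = H.
Proof.
move=> g2; apply/fsetP => x; rewrite !inE; have [->|_] := eqVneq x g => //=.
by rewrite g2F // ?andbF.
Qed.

(** Here v is a new element of H, the situation of [beta_prod_U1]. *)
Lemma ubeta_stepY : (v \in X) = false -> v \in Y -> (v \in E) = false ->
  ubeta E (v |` F) X Y = ubeta E F X Z +
    (p - 1) * \sum_(g <- X | (v < g)%O && (g \notin Y))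
      p ^+ th g Z * ubeta E F (X `\ g) (g |` Z).
Proof.
move=> vX vY vE; rewrite big_gt // /ubeta -/C.
have vZ : v \notin Z by rewrite !inE eqxx.
have XF : X `\` F = G.
  apply/fsetP => x; rewrite !inE; have [->|_] := eqVneq x v => //=.
  by rewrite vX andbF.
have -> : E `&` (v |` F) = C.
  by apply/fsetP => x; rewrite !inE; have [->|_] := eqVneq x v; rewrite ?vE.
have -> : (v |` F) `\` X = v |` H.
  apply/fsetP => x; rewrite !inE; have [->|_] := eqVneq x v => //=.
  by rewrite vX.
have -> : (v |` F) `&` X `\` E = D.
  apply/fsetP => x; rewrite !inE; have [->|_] := eqVneq x v => //=.
  by rewrite vX !andbF.
have -> : theta D Y = theta D Z by rewrite -(fsetD1K vY) thetaDg.
rewrite XF -/G -/D -/H -/e.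
have := beta_prod_U1 p_neq0 lt1v ltv2 ltHv; rewrite G12 => ->.
rewrite mulrDr; congr (_ + _); rewrite mulrCA; congr (_ * _).
rewrite mulr_sumr; apply: eq_big_seq => g g2.
rewrite (Drem g2) (Hrem g2) G1D // thetaDg ?g2Z //; last exact/ltW/ltv2.
have -> : X `\ g `\` F = G `\ g by rewrite -XF fsetDDl fsetUC -fsetDDl.
rewrite !mulrA; congr (_ * _).
have := th_gt (ltv2 g2); rewrite vX -/G -/H -(fsetD1K vY) -/Z thU1 //.
rewrite (ltv2 g2) => egt.
rewrite /e -(theta_rem g2) !exprnP -!expfzDr //; congr (p ^ _).
by apply/esym; exact: shift_gt.
Qed.

(** Here v is a new element of E \cap F and so lies outside G, but in the terms of the smaller
    problem that keep v in X it counts as an element of X \ F; [beta_prod_memU1] relates the two. *)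
Lemma ubeta_stepXY : v \in X -> v \in Y -> v \in E ->
  ubeta E (v |` F) X Y = p ^+ th v Y * ubeta E F (X `\ v) Y - (ubeta E F X Z +
    (p - 1) * \sum_(g <- X | (v < g)%O && (g \notin Y))
      p ^+ th g Z * ubeta E F (X `\ g) (g |` Z)).
Proof.
move=> vX vY vE; rewrite big_gt // /ubeta -/C.
have vZ : v \notin Z by rewrite !inE eqxx.
have XF : X `\` F = v |` G.
  by apply/fsetP => x; rewrite !inE; have [->|_] := eqVneq x v;
    rewrite ?vX ?vF0.
have XvF : X `\ v `\` F = G.
  apply/fsetP => x; rewrite !inE; have [->|_] /= := eqVneq x v.
    by rewrite andbF.
  by [].
have XvH : F `\` (X `\ v) = H.
  by apply/fsetP => x; rewrite !inE; have [->|_] := eqVneq x v;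
    rewrite ?vF0 ?andbF.
have XvD : F `&` (X `\ v) `\` E = D.
  by apply/fsetP => x; rewrite !inE; have [->|_] := eqVneq x v;
    rewrite ?vF0 ?andbF.
have -> : E `&` (v |` F) = v |` C.
  by apply/fsetP => x; rewrite !inE; have [->|_] := eqVneq x v; rewrite ?vE.
have -> : (v |` F) `\` X = H.
  by apply/fsetP => x; rewrite !inE; have [->|_] := eqVneq x v;
    rewrite ?vX ?vF0.
have -> : (v |` F) `&` X `\` E = D.
  by apply/fsetP => x; rewrite !inE; have [->|_] := eqVneq x v;
    rewrite ?vE ?vF0.
have thvC A : v \notin A ->
    theta (v |` (A `|` C)) E = (th v E + theta (A `|` C) E)%N.
  by move=> vA; rewrite theta_U1l // !inE vF0 negb_or vA andbF.
rewrite XF XvF XvH XvD.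
have -> : theta D Y = theta D Z by rewrite -(fsetD1K vY) thetaDg.
rewrite -/G -/D -/H fsetUCA thvC // -fsetUA thvC //.
have -> : p ^+ th v Y = p ^+ th v E * p ^ (#|` H|%:Z - (th v G)%:Z).
  rewrite !exprnP -expfzDr //; congr (p ^ _).
  exact: shift_eq th_eq.
have -> : \sum_(g <- G2) p ^+ th g Z *
    (p ^+ (theta (X `\ g `\` F `|` C) E +
       theta (F `&` (X `\ g) `\` E) (g |` Z)) *
     beta_prod p (X `\ g `\` F) (F `\` (X `\ g))) =
    p ^+ (th v E + e) * \sum_(g <- G2) p ^ (#|` H|%:Z - (th g G)%:Z - 1) *
      beta_prod p (v |` (G1 `|` (G2 `\ g))) H.
  rewrite mulr_sumr; apply: eq_big_seq => g g2.
  rewrite (Drem g2) (Hrem g2) G1D // thetaDg ?g2Z //; last exact/ltW/ltv2.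
  have -> : X `\ g `\` F = v |` (G `\ g).
    rewrite fsetDDl fsetUC -fsetDDl XF; apply/fsetP => x; rewrite !inE.
    have [->|_] := eqVneq x g => //=.
    by rewrite g2v.
  rewrite !mulrA; congr (_ * _).
  have := th_gt (ltv2 g2); rewrite vX -/G -/H -(fsetD1K vY) -/Z thU1 //.
  rewrite (ltv2 g2) => egt.
  rewrite -fsetUA thvC ?inE ?vG ?eqxx ?andbF //.
  rewrite /e -(theta_rem g2) !exprnP -!expfzDr //; congr (p ^ _).
  exact: shift_gtX.
have := beta_prod_memU1 p_neq0 lt1v ltv2 ltHv; rewrite G12 => ePi.
rewrite -addnA -/e {1}ePi !exprD; exact: recombine.
Qed.

Lemma ubeta_step : ubeta E (v |` F) X Y =
  (v \in X)%:R * (p ^+ th v Y * ubeta E F (X `\ v) Y) +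
  (v \in Y)%:R * (-1) ^+ (v \in E) * (ubeta E F X Z +
    (p - 1) * \sum_(g <- X | (v < g)%O && (g \notin Y))
      p ^+ th g Z * ubeta E F (X `\ g) (g |` Z)).
Proof.
(* Equality of contents at v leaves three of the eight membership patterns. *)
have := memXY v; rewrite eqxx.
have [vX|/negbTE vX] := boolP (v \in X); have [vY|/negbTE vY] := boolP (v \in
  Y);
  have [vE|/negbTE vE] := boolP (v \in E) => // _.
- by rewrite ubeta_stepXY //= expr1 !mul1r mulN1r.
- by rewrite ubeta_stepX //= mul1r !mul0r addr0.
- by rewrite ubeta_stepY //= expr0 mul0r add0r !mul1r.
Qed.

End Step.
End Weights.

(** * Closed form of the braiding of a monomial with a vector *)

Section BraidingVector.
Context {d : Order.disp_t} {B : orderType d} {K : fieldType}.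
Implicit Types (A C E F G H X Y : {fset B}) (b g v : B).

Local Notation L := {malg K[{fset B}]}.
Local Notation L2 := {malg K[({fset B} * {fset B})%type]}.
Local Notation e_ E := (@e1 d B K E).
Local Notation "E # F" := (@e2 d B K E F) (at level 30, no associativity).
Local Notation th g A := (theta [fset g] A).

Context {p : K} {tauhat : {linear L2 -> L2}}.
Context (tauhatP : is_braiding p tauhat).

Lemma wd_insert v A : wd (e_ [fset v]) (e_ A) =
  if v \in A then 0 else (-1) ^+ th v A *: e_ (v |` A).
Proof. by rewrite wdEE fdisjoint1X; case: (v \in A). Qed.

Definition swap_coef g v F : K := (1 - p) * p ^+ th g F * (-1) ^+ (th g F + th
  v F).

(** Moving leftwards through F, v either goes all the way or is exchanged once with some g > v. From
    then on g travels, past smaller vectors only, each giving -p and no further exchange. The extra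
    sign in [swap_coef] sorts v into F \ g. *)
Lemma tauhat_vec F v : tauhat (F # [fset v]) = (-1) ^+ #|` F| *:
  (p ^+ th v F *: ([fset v] # F) +
   \sum_(g <- F | (v < g)%O && (v \notin F))
     swap_coef g v F *: ([fset g] # (v |` (F `\ g)))).
Proof.
elim/(@fset_min_ind d B): F => [|b F ltbF IHF].
  rewrite (tauhat1l tauhatP) theta0r big_seq_cond big1 => [|g];
    last by rewrite inE.
  rewrite addr0.
  by rewrite ?cardfs0 !expr0 !scale1r.
have bF : b \notin F by apply/negP => /ltbF; rewrite ltxx.
have [h hD] : {h : {linear L2 -> L2} | h =1 lin (fun HF =>
    rmul (e_ HF.2) (tauhat ([fset b] # HF.1)))}.
  by exists (lin (fun HF : {fset B} * {fset B} =>
    rmul (e_ HF.2) (tauhat ([fset b] # HF.1)))).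
have hE G H : h (G # H) = rmul (e_ H) (tauhat ([fset b] # G)).
  by rewrite hD lin_e2.
transitivity (h (tauhat (F # [fset v]))).
  by rewrite hD -tnEE -(wd_min ltbF) (tauhat_wedgel tauhatP).
rewrite IHF mlinearZ linearD mlinearZ linear_sum hE.
under eq_bigr => g _ do rewrite mlinearZ hE.
rewrite cardfsU1 bF exprS mulN1r.
have rem g : g \in F -> (b |` F) `\ g = b |` (F `\ g).
  move=> gF; apply/fsetP => x; rewrite !inE; have [->|_] := eqVneq x b.
    by rewrite /= ?andbT; apply: contraTneq gF => <-.
  by rewrite /=.
have thg g : g \in F -> th g (b |` F) = (th g F).+1.
  by move=> /ltbF ltbg; rewrite thU1 // ltbg.
have tb g : g \in F -> tauhat ([fset b] # [fset g]) = - p *: ([fset g] # [fset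
  b]).
  move=> /ltbF ltbg; rewrite (tauhat11 tauhatP) (lt_eqF ltbg) (lt_gtF ltbg).
  reflexivity.
rewrite big_mkcond [in RHS]big_mkcond /= (big_fsetU1 _ _ bF) /=.
rewrite mscaleNr -mscalerN; apply: f_equal2; first reflexivity.
case: (ltgtP b v) => [ltbv|ltvb|eqbv].
- have nbv : v != b by rewrite neq_lt ltbv orbT.
  rewrite add0r opprD; apply: f_equal2; last rewrite -sumrN.
    rewrite (tauhat11 tauhatP) (lt_eqF ltbv) (lt_gtF ltbv).
    rewrite (mlinearZ (rmul (e_ F))) /= rmulE (wd_min ltbF) tnEE (thU1 _ bF)
      ltbv exprS.
    rewrite mscalerA mulrN -mscaleNr mulrC; reflexivity.
  apply: eq_big_seq => g gF; rewrite !inE negb_or nbv /=.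
  case: ((v < g)%O && (v \notin F)); last exact/esym/oppr0.
  have ltb x : x \in v |` (F `\ g) -> (b < x)%O.
    by rewrite !inE => /predU1P[->//|/andP[_ /ltbF]].
  rewrite (tb _ gF) (mlinearZ (rmul _)) /= rmulE (wd_min ltb) tnEE (rem _ gF).
  rewrite (fsetUCA [fset b] [fset v]) mscalerA -mscaleNr.
  apply: f_equal2; last reflexivity.
  by rewrite /swap_coef thg // thU1 // ltbv add1n addSn addnS !exprS; ring.
- have nbv : v != b by rewrite neq_lt ltvb.
  have ltvF x : x \in F -> (v < x)%O by move=> /ltbF; apply: lt_trans ltvb.
  have vF : v \notin F by apply/negP => /ltvF; rewrite ltxx.
  have thv : th v (b |` F) = th v F by rewrite thU1 // (lt_gtF ltvb).
  have thv0 : th v F = 0%N by apply: th_empty => y /ltvF/ltW.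
  have thb0 : th b (b |` F) = 0%N.
    by apply: th_empty => y; rewrite !inE => /predU1P[->//|/ltbF/ltW].
  rewrite (tauhat11 tauhatP) (gt_eqF ltvb) ltvb.
  rewrite (linearB (rmul (e_ F))) (mlinearZ (rmul (e_ F))) /= !rmulE.
  rewrite (wd_min ltbF) (wd_min ltvF) !tnEE !inE negb_or nbv vF /=.
  rewrite thv thv0 /swap_coef thb0 thv thv0 expr0 !mscale1r !mulr1 (fsetU1K bF).
  rewrite mscaleNr !opprD addrA; apply: f_equal2; last rewrite -sumrN.
    rewrite addrC; reflexivity.
  apply: eq_big_seq => g gF.
  case: (v < g)%O; last exact/esym/oppr0.
  have -> : true && true by [].
  rewrite (tb _ gF) (mlinearZ (rmul _)) /= rmulE wd_insert.
  have bA : b \notin v |` (F `\ g).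
    by rewrite !inE negb_or eq_sym nbv (negPf bF) andbF.
  rewrite (negPf bA) !tnE tensZr -!tnE tnEE (rem _ gF) (fsetUCA [fset b] [fset
    v]).
  rewrite !mscalerA -mscaleNr; apply: f_equal2; last reflexivity.
  have -> : th b (v |` F `\ g) = 1%N.
    rewrite thU1 ?inE ?(negPf vF) ?andbF // ltvb th_empty // => y.
    by rewrite !inE => /andP[_ /ltbF/ltW].
  by rewrite (thg _ gF) ?thv ?thv0 ?addn0 !exprS ?expr0; ring.
(* When b = v, every exchange term gets v twice in its second factor and vanishes. *)
- subst v.
  rewrite add0r opprD; apply: f_equal2; last rewrite -sumrN.
    rewrite (tauhat11 tauhatP) eqxx (linearN (rmul (e_ F))) /= rmulE.
    rewrite (wd_min ltbF) tnEE (thU1 _ bF) ltxx mscalerN; reflexivity.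
  apply: eq_big_seq => g gF; rewrite fset1U1 andbF oppr0.
  case: (_ && _); last reflexivity.
  rewrite (tb _ gF) (mlinearZ (rmul _)) /= rmulE wd_insert fset1U1.
  by rewrite tnE tens0r !scaler0.
Qed.

End BraidingVector.

(** * Coefficients of a right product by Delta(v) *)

Section mulDeltaCoefficients.
Context {d : Order.disp_t} {B : orderType d} {K : fieldType}.
Implicit Types (A C E F G H X Y : {fset B}) (b g v : B).

Local Notation L := {malg K[{fset B}]}.
Local Notation L2 := {malg K[({fset B} * {fset B})%type]}.
Local Notation e_ E := (@e1 d B K E).
Local Notation "E # F" := (@e2 d B K E F) (at level 30, no associativity).
Local Notation th g A := (theta [fset g] A).

Lemma mcoeff_e2 A C X Y : (A # C)@_(X, Y) = ((A == X) && (C == Y))%:R.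
Proof. by rewrite e2E /fEF /fE tensUU mcoeffU xpair_eqE. Qed.

Lemma linear_functional (f : L2 -> K) (s : seq ({fset B} * {fset B})) c :
  (forall a u w, f (a *: u + w) = a * f u + f w) ->
  f (\sum_(i <- s) c i *: (i.1 # i.2)) = \sum_(i <- s) c i * f (i.1 # i.2).
Proof.
move=> fD; have f0 : f 0 = 0.
  have := fD 1 0 0; rewrite scaler0 addr0 mul1r => /eqP.
  by rewrite -{1}[f 0]addr0 (inj_eq (addrI _)) eq_sym => /eqP.
elim: s => [|i s IHs]; first by rewrite !big_nil.
by rewrite !big_cons fD IHs.
Qed.

Lemma functional_ext (f g : L2 -> K) :
  (forall a u w, f (a *: u + w) = a * f u + f w) ->
  (forall a u w, g (a *: u + w) = a * g u + g w) ->
  (forall A C, f (A # C) = g (A # C)) -> f =1 g.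
Proof.
move=> fD gD fg u; rewrite -[u]lin_id2 linE !linear_functional //.
by apply: eq_bigr => i _; rewrite fg.
Qed.

Lemma fsetU1_eqD1 v A X :
  (v \notin A) && (v |` A == X) = (v \in X) && (A == X `\ v).
Proof.
apply/andP/andP => [[vA /eqP<-]|[vX /eqP->]].
  by rewrite fset1U1 fsetU1K.
by rewrite fsetD1K // !inE eqxx.
Qed.

(** Replacing h by v in C and v by h in Y are inverse operations; this reindexes the exchange sum
    from its source C to its target Y. *)
Lemma swap_eq v h C Y : (v == h) = false ->
  [&& h \in C, v \notin C & v |` (C `\ h) == Y] =
  [&& v \in Y, h \notin Y & C == h |` (Y `\ v)].
Proof.
move=> nvh; apply/and3P/and3P => [[hC vC /eqP<-]|[vY hY /eqP->]].
  split; rewrite ?fset1U1 // ?inE ?eqxx ?orbF ?andbF ?orbF 1?eq_sym ?nvh //.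
  by rewrite fsetU1K ?fsetD1K // !inE negb_and vC orbT.
split; rewrite ?fset1U1 // ?inE ?eqxx ?orbF ?nvh //.
by rewrite fsetU1K ?fsetD1K // !inE negb_and hY orbT.
Qed.

Lemma wd_append A v : wd (e_ A) (e_ [fset v]) =
  if v \in A then 0 else (-1) ^+ theta A [fset v] *: e_ (v |` A).
Proof. by rewrite wdEE fdisjointX1 fsetUC; case: (v \in A). Qed.

Lemma mcoeff_appendl v A C X Y :
  (tn (wd (e_ A) (e_ [fset v])) (e_ C))@_(X, Y) =
  (v \in X)%:R * (-1) ^+ theta (X `\ v) [fset v] *
    ((A == X `\ v) && (C == Y))%:R.
Proof.
have := fsetU1_eqD1 v A X; rewrite wd_append.
have [vA|vA] := boolP (v \in A) => /=.
  rewrite tnE tens0l mcoeff0; have [vX|_] := boolP (v \in X) => /=.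
    by move=> <-; rewrite mulr0.
  by rewrite !mul0r.
rewrite tnE tensZl -tnE tnEE mcoeffZ mcoeff_e2 => ->.
have [vX|_] /= := boolP (v \in X); last by rewrite !mul0r mulr0.
by rewrite mul1r; have [->|_] /= := eqVneq A (X `\ v); rewrite ?mulr0.
Qed.

Lemma mcoeff_appendr v A C X Y :
  (tn (e_ A) (wd (e_ C) (e_ [fset v])))@_(X, Y) =
  (v \in Y)%:R * (-1) ^+ theta (Y `\ v) [fset v] *
    ((A == X) && (C == Y `\ v))%:R.
Proof.
have := fsetU1_eqD1 v C Y; rewrite wd_append.
have [vA|vA] := boolP (v \in C) => /=.
  rewrite tnE tens0r mcoeff0; have [vX|_] := boolP (v \in Y) => /=.
    by move=> <-; rewrite andbF mulr0.
  by rewrite !mul0r.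
rewrite tnE tensZr -tnE tnEE mcoeffZ mcoeff_e2 => ->.
have [vX|_] /= := boolP (v \in Y); last by rewrite andbF !mul0r mulr0.
by rewrite mul1r; have [->|_] /= := eqVneq C (Y `\ v); rewrite ?andbF ?mulr0.
Qed.

Lemma sum_fset_cond A U (P : pred B) (f : B -> K) : A `<=` U ->
  \sum_(g <- A | P g) f g = \sum_(g <- U) (if (g \in A) && P g then f g else 0).
Proof.
move=> AU; rewrite big_mkcond /=.
transitivity (\sum_(g <- A) if (g \in A) && P g then f g else 0).
  by apply: eq_big_seq => g ->.
by apply: big_fset_incl => // g _ /negPf->.
Qed.

Context {p : K} {tauhat : {linear L2 -> L2}}.
Context (tauhatP : is_braiding p tauhat).

(** The transposed operator. The pair (X, Y) has three kinds of sources: v was carried across Y into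
    X, v was appended to the second factor, or v entered the second factor and expelled g into the
    first. *)
Lemma mcoeff_mulDelta v u X Y : (mulDelta tauhat v u)@_(X, Y) =
  (v \in X)%:R * ((-1) ^+ (#|` Y| + theta (X `\ v) [fset v]) * p ^+ th v Y *
    u@_(X `\ v, Y)) +
  (v \in Y)%:R * ((-1) ^+ theta (Y `\ v) [fset v] * u@_(X, Y `\ v) +
    \sum_(g <- X | (v < g)%O && (g \notin Y))
      (-1) ^+ (#|` Y| + theta (X `\ g) [fset g]) *
      swap_coef (p := p) g v (g |` (Y `\ v)) * u@_(X `\ g, g |` (Y `\ v))).
Proof.
pose f w := (mulDelta tauhat v w)@_(X, Y).
pose g w := (v \in X)%:R * ((-1) ^+ (#|` Y| + theta (X `\ v) [fset v]) *
    p ^+ th v Y * w@_(X `\ v, Y)) +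
  (v \in Y)%:R * ((-1) ^+ theta (Y `\ v) [fset v] * w@_(X, Y `\ v) +
    \sum_(g <- X | (v < g)%O && (g \notin Y))
      (-1) ^+ (#|` Y| + theta (X `\ g) [fset g]) *
      swap_coef (p := p) g v (g |` (Y `\ v)) * w@_(X `\ g, g |` (Y `\ v))).
rewrite -/(f u) -/(g u); apply: functional_ext.
- by move=> a x y; rewrite /f linearP mcoeffD mcoeffZ.
- move=> a x y; rewrite /g !mcoeffD !mcoeffZ.
  under eq_bigr => z _ do rewrite mcoeffD mcoeffZ mulrDr (mulrCA _ a).
  rewrite big_split /= -mulr_sumr; ring.
move=> A C; rewrite /f /g mulDeltaE mcoeffD rmulE mcoeff_appendr !mcoeff_e2.
rewrite (tauhat_vec tauhatP).
rewrite (mlinearZ (lmul (e_ A))) /= (linearD (lmul (e_ A))).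
rewrite (mlinearZ (lmul (e_ A))) (linear_sum (lmul (e_ A))) /=.
rewrite mcoeffZ mcoeffD mcoeffZ raddf_sum /= lmulE mcoeff_appendl.
rewrite mulrDr -addrA; congr (_ + _).
  have [->|_] := eqVneq C Y; last by rewrite !andbF !mulr0.
  by rewrite exprD; ring.
rewrite addrC [RHS]mulrDr; congr (_ + _); first by rewrite mulrA.
(* The sums run over C and over X; extended by zero to their union they agree term by term. *)
rewrite mulr_sumr mulr_sumr (sum_fset_cond _ _ (fsubsetUl C X)).
rewrite (sum_fset_cond _ _ (fsubsetUr C X)).
apply: eq_bigr => h _.
rewrite (mlinearZ (lmul (e_ A))) /= mcoeffZ lmulE mcoeff_appendl.
have [ltvh|] /= := boolP (v < h)%O; last by rewrite !andbF.
rewrite mcoeff_e2.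
have := swap_eq C Y (lt_eqF ltvh).
have [/and3P[vY hY /eqP eC]|nY] := boolP [&& v \in Y, h \notin Y & _].
  move=> /and3P[hC vC /eqP eY].
  have cCY : #|` C| = #|` Y|.
    by rewrite (cardfsD1 h) hC -eY cardfsU1 !inE negb_and vC orbT.
  rewrite hC vC hY vY -eC eY !eqxx cCY ?andbT /= exprD.
  case: (h \in X); last by rewrite !mul0r !mulr0.
  by case: (A == X `\ h) => /=; ring.
move=> nC; transitivity (0 : K); last apply/esym.
  case: ifP => // /andP[hC vC]; move: nC; rewrite hC vC /= => ->.
  by rewrite andbF !mulr0.
case: ifP => // /andP[_ hY]; move: nY; rewrite hY /=.
case: (v \in Y) => /= [/negPf->|_]; last by rewrite mul0r.
by rewrite andbF !mulr0.
Qed.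

End mulDeltaCoefficients.

(** * Parity of the inversion counts *)

Section Signs.
Context {R : comPzRingType}.

Fact eq_sign (n m k l : nat) :
  (n + k.*2 = m + l.*2)%N -> (-1) ^+ n = (-1) ^+ m :> R.
Proof.
move=> e; rewrite -signr_odd -[RHS]signr_odd.
by have := congr1 odd e; rewrite !oddD !odd_double !addbF => ->.
Qed.

Fact recombine_coef (s1 u a s2 s3 b : R) :
  s1 * (u * a * s2) * (s3 * b) = s1 * (u * s2) * s3 * (a * b).
Proof. by ring. Qed.

(** In the three parity checks [e] and [y] are the cardinals of E and Y, [b] tells whether v is in
    E, and names like [yv] stand for [theta Y [fset v]]. The hypotheses split cardinals at v and
    express equality of contents above v. *)
Fact sign_stepX (q e y a yv vy ev ve tF tA : nat) (b : bool) :
  y = (yv + vy + b)%N -> e = (ev + ve + b)%N -> (a + yv = ev)%N ->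
  (-1) ^+ (y + a) * (-1) ^+ (q + tF + tA) =
  (-1) ^+ (q + e + (ve + tF) + (vy + tA)) :> R.
Proof. by move=> ? ? ?; rewrite -exprD; apply: (@eq_sign _ _ ve 0); lia. Qed.

Fact sign_stepY (q e z xv xz ev ve tF : nat) (b : bool) :
  e = (ev + ve + b)%N -> (xv + z = ev)%N ->
  (-1) ^+ z * (-1) ^+ (q + tF + xz) =
  (-1) ^+ (q + e + (ve + tF) + (xv + xz)) * (-1) ^+ b :> R.
Proof.
by move=> ? ?; rewrite -!exprD; apply: (@eq_sign _ _ (xv + ve + b) 0); lia.
Qed.

Fact sign_stepG (q e y ag gz vz z az av ev ve tF : nat) (b : bool) (u : R) :
  e = (ev + ve + b)%N -> (av + 1 + z = ev)%N -> y = (1 + z + vz)%N ->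
  (-1) ^+ (y + ag) * ((1 - u) * (-1) ^+ (gz + vz)) *
    (-1) ^+ (q + tF + (ag + az)) =
  (-1) ^+ (q + e + (ve + tF) + (1 + gz + (av + az))) * (-1) ^+ b * (u - 1).
Proof.
move=> ? ? ?; have -> : 1 - u = (-1) ^+ 1 * (u - 1) by rewrite expr1; ring.
rewrite [LHS](_ : _ = (-1) ^+ (y + ag + 1 + (gz + vz) + (q + tF + (ag + az))) *
  (u - 1)); last by rewrite !(exprD _ (_ + _)); ring.
rewrite -exprD; congr (_ * _).
by apply: (@eq_sign _ _ (av + ve + b) (vz + ag)); lia.
Qed.

End Signs.

Section ContentSteps.
Context {d : Order.disp_t} {B : orderType d}.
Implicit Types (E F X Y : {fset B}) (g v : B).

Lemma same_contentDl E F X Y v : v \notin F -> v \in X ->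
  same_content E F (X `\ v) Y = same_content E (v |` F) X Y.
Proof.
move=> vF vX; apply/same_contentP/same_contentP => e x; move: (e x);
  rewrite !inE; have [->|_] //= := eqVneq x v; rewrite vX (negPf vF) /=;
  by do 2!case: (v \in _).
Qed.

Lemma same_contentDr E F X Y v : v \notin F -> v \in Y ->
  same_content E F X (Y `\ v) = same_content E (v |` F) X Y.
Proof.
move=> vF vY; apply/same_contentP/same_contentP => e x; move: (e x);
  rewrite !inE; have [->|_] //= := eqVneq x v; rewrite vY (negPf vF) /=;
  by do 2!case: (v \in _).
Qed.

Lemma same_content_swap E F X Y g : g \in X -> g \notin Y ->
  same_content E F (X `\ g) (g |` Y) = same_content E F X Y.
Proof.
move=> gX gY; apply/same_contentP/same_contentP => e x; move: (e x);
  rewrite !inE; have [->|_] //= := eqVneq x g; rewrite gX (negPf gY) /=;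
  by do 2!case: (g \in _).
Qed.

End ContentSteps.

(** * Coefficients of (1 (x) f_E) Delta(f_F) *)

Section TopCoefficients.
Context {d : Order.disp_t} {B : orderType d} {K : fieldType}.
Implicit Types (A C E F G H X Y : {fset B}) (b g v : B).

Local Notation L := {malg K[{fset B}]}.
Local Notation L2 := {malg K[({fset B} * {fset B})%type]}.
Local Notation e_ E := (@e1 d B K E).
Local Notation "E # F" := (@e2 d B K E F) (at level 30, no associativity).
Local Notation th g A := (theta [fset g] A).

Context {p : K} {tauhat : {linear L2 -> L2}} {Delta : {linear L -> L2}}.
Context (p_neq0 : p != 0).
Context (tauhatP : is_braiding p tauhat) (DeltaP : is_coproduct tauhat Delta).

(** The sign of [beta] times the prefactor (-1)^(|E| |F|) of rho. *)
Definition content_sign E F X Y : K :=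
  (-1) ^+ (#|` E| * #|` F| + theta F E + theta X Y).

(** For empty F a nonempty X inside E can still have the right content; the exponent at its smallest
    element is 0, which kills the product. *)
Lemma ubeta0 E X Y : X != fset0 -> ubeta (p := p) E fset0 X Y = 0.
Proof.
move=> X0; rewrite /ubeta fsetD0 fset0D.
have [->|] := beta_prod_idx (p := p) X fset0; first by rewrite mulr0.
by rewrite /idx cardfs0 leqn0 cardfs_eq0 (negPf X0).
Qed.

Lemma ubeta00 E : ubeta (p := p) E fset0 fset0 E = 1.
Proof.
rewrite /ubeta fset0D fsetI0 fsetU0 fset0I fset0D !theta0l expr0 mul1r.
by rewrite /beta_prod big_seq_fset0.
Qed.

Lemma theta_content E F X Y v : same_content E F X Y ->
  (forall x, x \in F -> (x < v)%O) ->
  (theta X [fset v] + theta Y [fset v] = theta E [fset v])%N.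
Proof.
move=> sc ltFv; rewrite -[RHS]addn0 -(@theta_r0 _ _ F v) => [|x /ltFv/ltW //].
by rewrite !theta_r1; apply: same_content_sum.
Qed.

(** Multiplication by Delta(v) respects contents, so a pair (X, Y) of wrong content has only zero
    sources. For the right content [mcoeff_mulDelta] and [ubeta_step] match term by term up to the
    parity checks. *)
Lemma mcoeff_braid_mul E F X Y : (braid_mul tauhat E (Delta (e_ F)))@_(X, Y) =
  if same_content E F X Y then content_sign E F X Y * ubeta (p := p) E F X Y
    else 0.
Proof.
elim/(@fset_max_ind d B): F X Y => [|v F ltFv IHF] X Y.
  rewrite (Delta0 DeltaP) (braid_mul0 tauhatP) mcoeff_e2.
  have [->|X0] := eqVneq X fset0; last first.
    by rewrite ubeta0 // mulr0 if_same.
  rewrite /same_content fset0U fsetU0 fset0I fsetI0 eqxx andbT /= (eq_sym Y).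
  case: eqVneq => [->|] //.
  by rewrite ubeta00 /content_sign cardfs0 muln0 !theta0l expr0 mulr1.
have vF : v \notin F by apply/negP => /ltFv; rewrite ltxx.
rewrite (braid_mul_Delta_max tauhatP DeltaP) // (mcoeff_mulDelta tauhatP) !IHF.
under eq_bigr => g _ do rewrite IHF.
have swap g : v \in Y -> g \in X -> (v < g)%O && (g \notin Y) ->
    same_content E F (X `\ g) (g |` (Y `\ v)) = same_content E (v |` F) X Y.
  move=> vY gX /andP[_ gY]; rewrite same_content_swap ?same_contentDr //.
  by rewrite !inE (negPf gY) andbF.
have [sc|nsc] := boolP (same_content E (v |` F) X Y); last first.
  transitivity (0 + 0 : K); last by rewrite addr0.
  congr (_ + _).
    have [vX|_] := boolP (v \in X); last by rewrite mul0r.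
    by rewrite same_contentDl // (negPf nsc) !mulr0.
  have [vY|_] := boolP (v \in Y); last by rewrite mul0r.
  rewrite same_contentDr // (negPf nsc) mulr0 add0r big_seq_cond big1 ?mulr0 //.
  by move=> g /andP[gX gP]; rewrite swap // (negPf nsc) mulr0.
have cE := card_theta v E.
have csF : (#|` E| * #|` v |` F| = #|` E| * #|` F| + #|` E|)%N.
  by rewrite cardfsU1 vF mulnDr muln1 addnC.
have tF : theta (v |` F) E = (th v E + theta F E)%N by rewrite theta_U1l.
rewrite (ubeta_step p_neq0 ltFv sc) [RHS]mulrDr; congr (_ + _).
  have [vX|_] := boolP (v \in X); last by rewrite !mul0r mulr0.
  rewrite same_contentDl // sc !mul1r.
  have vXv : v \notin X `\ v by rewrite !inE eqxx.
  have tX : theta X Y = (th v Y + theta (X `\ v) Y)%N.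
    by rewrite -theta_U1l // fsetD1K.
  have vYE : (v \in Y) = (v \in E).
    have /same_contentP/(_ v) := sc; rewrite vX !inE eqxx.
    by case: (v \in Y); case: (v \in E).
  have cY := card_theta v Y; rewrite vYE in cY.
  have tv : (theta (X `\ v) [fset v] + theta Y [fset v] = theta E [fset v])%N.
    by apply: (theta_content (F := F)) ltFv; rewrite same_contentDl.
  have := sign_stepX (#|` E| * #|` F|) (theta F E) (theta (X `\ v) Y) cY cE tv.
  rewrite /content_sign csF tF tX => <-.
  exact: mulrACA.
have [vY|_] := boolP (v \in Y); last by rewrite !mul0r mulr0.
have vZ : v \notin Y `\ v by rewrite !inE eqxx.
have tY A : theta A Y = (theta A [fset v] + theta A (Y `\ v))%N.
  by rewrite -theta_U1r // fsetD1K.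
have tv : (theta X [fset v] + theta (Y `\ v) [fset v] = theta E [fset v])%N.
  by apply: (theta_content (F := F)) ltFv; rewrite same_contentDr.
rewrite same_contentDr // sc !mul1r [RHS]mulrA [RHS]mulrDr; congr (_ + _).
  rewrite mulrA; congr (_ * _).
  rewrite /content_sign csF tF tY; exact: sign_stepY cE tv.
rewrite mulrA mulr_sumr big_seq_cond [RHS]big_seq_cond; apply: eq_bigr.
move=> g /andP[gX gP]; rewrite swap // sc.
have /andP[ltvg gY] := gP.
have gZ : g \notin Y `\ v by rewrite !inE (negPf gY) andbF.
have gXg : g \notin X `\ g by rewrite !inE eqxx.
have tg1 A : g \notin A -> theta (g |` A) [fset v] = (theta A [fset v] + 1)%N.
  by move=> gA; rewrite theta_U1l // th_sum big_seq_fset1 ltvg addnC.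
have cY : #|` Y| = (1 + theta (Y `\ v) [fset v] + th v (Y `\ v))%N.
  by rewrite (cardfsD1 v) vY (card_theta v (Y `\ v)) (negPf vZ) addn0 addnA.
have tvX : (theta (X `\ g) [fset v] + 1 + theta (Y `\ v) [fset v] =
    theta E [fset v])%N by rewrite -tg1 // fsetD1K.
have := sign_stepG (#|` E| * #|` F|) (theta (X `\ g) [fset g]) (th g (Y `\ v))
  (theta (X `\ g) (Y `\ v)) (theta F E) p cE tvX cY.
have -> : swap_coef (p := p) g v (g |` (Y `\ v)) = (1 - p) * p ^+ th g (Y `\ v)
  *
    (-1) ^+ (th g (Y `\ v) + th v (Y `\ v)).
  by rewrite /swap_coef !thU1 // ltxx (lt_gtF ltvg).
rewrite {1}/content_sign (theta_U1r _ gZ) recombine_coef => ->.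
have tXY : theta X Y = (1 + th g (Y `\ v) +
    (theta (X `\ g) [fset v] + theta (X `\ g) (Y `\ v)))%N.
  rewrite -{1}(fsetD1K gX) (theta_U1l _ gXg) !tY.
  by rewrite th_sum big_seq_fset1 ltvg.
by rewrite /content_sign csF tF tXY.
Qed.

End TopCoefficients.

(** * Correspondence between (G, H) and (F', E') *)

Section Exchange.
Context {d : Order.disp_t} {B : orderType d}.
Implicit Types (E F G H X Y : {fset B}).

Lemma exch_content E F G H : G `<=` E `\` F -> H `<=` F `\` E ->
  same_content E F (exch F H G) (exch E G H).
Proof.
move=> /fsubsetP GE /fsubsetP HF; apply/same_contentP => x.
have /implyP := GE x; have /implyP := HF x; rewrite !inE.
by case: (x \in G) (x \in H) (x \in E) (x \in F) => [] [] [] [].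
Qed.

Lemma exch_D E F G H : G `<=` E `\` F -> H `<=` F `\` E ->
  [/\ exch F H G `\` F = G, F `\` exch F H G = H &
      F `&` exch F H G `\` E = F `\` E `\` H].
Proof.
move=> /fsubsetP GE /fsubsetP HF; split; apply/fsetP => x;
  have /implyP := GE x; have /implyP := HF x; rewrite !inE;
  by case: (x \in G) (x \in H) (x \in E) (x \in F) => [] [] [] [].
Qed.

(** Each target basis vector of the right content thus comes from exactly one pair (G, H) of the
    sum. *)
Lemma content_exch E F X Y : same_content E F X Y ->
  [/\ X `\` F `<=` E `\` F, F `\` X `<=` F `\` E,
      exch F (F `\` X) (X `\` F) = X & exch E (X `\` F) (F `\` X) = Y].
Proof.
move=> /same_contentP e; split; [apply/fsubsetP|apply/fsubsetP|apply/fsetP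
  |apply/fsetP] => x; move: (e x); rewrite !inE;
  by case: (x \in E) (x \in F) (x \in X) (x \in Y) => [] [] [] [].
Qed.

End Exchange.

Fact cancel_sign (R : comPzRingType) n (s a b c : R) :
  (-1) ^+ n * (a * ((-1) ^+ n * s * (b * c))) = a * (s * b * c).
Proof.
rewrite [LHS](_ : _ = (-1) ^+ n * (-1) ^+ n * (a * (s * b * c))); last by ring.
by rewrite -expr2 sqrr_sign mul1r.
Qed.

Theorem proposition6 (K : fieldType) (d : Order.disp_t) (B : orderType d)
    (p t : K) (p_neq0 : p != 0) (t_neq0 : t != 0)
    (tauhat : {linear {malg K[({fset B} * {fset B})%type]} ->
                      {malg K[({fset B} * {fset B})%type]}})
    (Delta : {linear {malg K[{fset B}]} ->
                     {malg K[({fset B} * {fset B})%type]}})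
    (S : {linear {malg K[{fset B}]} -> {malg K[{fset B}]}})
    (tauhatP : is_braiding p tauhat)
    (DeltaP : is_coproduct tauhat Delta)
    (SP : is_antipode Delta S)
    (E F : {fset B}) :
  let r G H := rcoef t tauhat Delta S E G F H in
  let r_formula G H :=
    t ^+ #|` exch F H G| * qpoch (t * p ^+ #|` E|) p (#|` H| - #|` G|) *
    beta p E G F H in
  [/\ forall G H : {fset B}, G `<=` E `\` F -> H `<=` F `\` E ->
        idx_inj G H -> r G H = r_formula G H,
      forall G H : {fset B}, G `<=` E `\` F -> H `<=` F `\` E ->
        idx G H -> r G H = r_formula G H
    & rho t tauhat Delta S (fEF E F) =
        (-1) ^+ (#|` E| * #|` F|) *:
        \sum_(G <- fpowerset (E `\` F))
          \sum_(H <- fpowerset (F `\` E) | idx G H)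
            r G H *: fEF (exch F H G) (exch E G H)].
Proof.
move=> r r_formula.
have rhoXY X Y := mcoeff_rho tauhatP DeltaP SP t E F X Y.
have formula G H : G `<=` E `\` F -> H `<=` F `\` E -> r G H = r_formula G H.
  move=> GE HF; have sc := exch_content GE HF; have [eG eH eD] := exch_D GE HF.
  rewrite /r /rcoef -e2E rhoXY (mcoeff_braid_mul p_neq0 tauhatP DeltaP) sc.
  (* From |E'| + |G| = |E| + |H| the truncated differences agree as well; this is the length of the
     q-Pochhammer symbol. *)
  have -> : (#|` exch E G H| - #|` E| = #|` H| - #|` G|)%N.
    have dGH : [disjoint E `\` G & H]%fset.
      by apply/fdisjointP => x; rewrite inE => /andP[_ xE]; apply/negP;
        move=> /(fsubsetP HF); rewrite inE xE.
    have GE' : G `<=` E by apply: fsubset_trans GE (fsubsetDl _ _).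
    have := cardfsUI (E `\` G) H; rewrite (eqP dGH) cardfs0 addn0 -/(exch E G
      H).
    have := cardfsDS GE'; have := fsubset_leq_card GE'.
    lia.
  rewrite /r_formula /beta /content_sign /ubeta eG eH eD -addnA (exprD _ (_ *
    _)).
  exact: cancel_sign.
split=> [G H GE HF _|G H GE HF _|]; [exact: formula|exact: formula|].
apply/malgP => -[X Y].
have mfEF G H : (fEF G H : {malg K[({fset B} * {fset B})%type]})@_(X, Y) =
    ((G == X) && (H == Y))%:R by rewrite -e2E mcoeff_e2.
rewrite mcoeffZ.
have -> : (\sum_(G <- fpowerset (E `\` F)) \sum_(H <- fpowerset (F `\` E) | idx
  G H)
      r G H *: fEF (exch F H G) (exch E G H))@_(X, Y) =
    \sum_(G <- fpowerset (E `\` F)) \sum_(H <- fpowerset (F `\` E) | idx G H)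
      r G H * ((exch F H G == X) && (exch E G H == Y))%:R.
  rewrite raddf_sum; apply: eq_bigr => G _.
  rewrite raddf_sum; apply: eq_bigr => H _.
  rewrite -mfEF; exact: mcoeffZ.
have [sc|nsc] := boolP (same_content E F X Y); last first.
  rewrite -e2E rhoXY (mcoeff_braid_mul p_neq0 tauhatP DeltaP) (negPf nsc) mulr0.
  rewrite big_seq big1 ?mulr0 // => G; rewrite fpowersetE => GE.
  rewrite big_seq_cond big1 // => H; rewrite fpowersetE => /andP[HF _].
  case: andP => [[/eqP eX /eqP eY]|_]; last by rewrite mulr0.
  by move: nsc; rewrite -eX -eY exch_content.
have [GE HF eX eY] := content_exch sc.
set G0 := X `\` F in GE eX eY; set H0 := F `\` X in HF eX eY.
have GE' : G0 \in fpowerset (E `\` F) by rewrite fpowersetE.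
have HF' : H0 \in fpowerset (F `\` E) by rewrite fpowersetE.
have uniq G H : G `<=` E `\` F -> H `<=` F `\` E ->
    (exch F H G == X) && (exch E G H == Y) = (G == G0) && (H == H0).
  move=> G1 H1; apply/andP/andP => [[/eqP eX1 _]|[/eqP-> /eqP->]]; last first.
    by rewrite eX eY.
  have [eG eH _] := exch_D G1 H1.
  by split; [rewrite -eG eX1|rewrite -eH eX1].
have -> : \sum_(G <- fpowerset (E `\` F)) \sum_(H <- fpowerset (F `\` E) | idx
  G H)
    r G H * ((exch F H G == X) && (exch E G H == Y))%:R =
    (idx G0 H0)%:R * r G0 H0.
  rewrite (big_fsetD1 G0) //= [X in _ + X](_ : _ = 0) ?addr0; last first.
    rewrite big_seq big1 // => G; rewrite !inE fpowersetE => /andP[nG G1].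
    rewrite big_seq_cond big1 // => H; rewrite fpowersetE => /andP[H1 _].
    by rewrite uniq // (negPf nG) mulr0.
  rewrite big_mkcond (big_fsetD1 H0) //= [X in _ + X](_ : _ = 0) ?addr0.
    by rewrite uniq // !eqxx mulr1; case: idx; rewrite ?mul1r ?mul0r.
  rewrite big_seq big1 // => H; rewrite !inE fpowersetE => /andP[nH H1].
  by rewrite uniq // (negPf nH) andbF mulr0 if_same.
rewrite /r /rcoef eX eY mulrCA [X in _ = _ * X]mulrA -expr2 sqrr_sign mul1r.
(* A pair outside [idx] is missing from the sum, and its coefficient is zero because the product
   over G vanishes. *)
have [_|nidx] := boolP (idx G0 H0); first exact/esym/mul1r.
rewrite mul0r -e2E rhoXY (mcoeff_braid_mul p_neq0 tauhatP DeltaP) sc /ubeta.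
have [->|] := beta_prod_idx (p := p) G0 H0; first by rewrite !mulr0.
by rewrite (negPf nidx).
Qed.
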